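(* There exist rational functions $R_m=R_m(a,b,c,e,f)$ and $Q_m=Q_m(a,b,c,e,f)$ such that for every integer $m\ge2$ $$ {}_{4}F_3\!\left(\begin{matrix}a,b,c,f+1\\ b+m,e,f\end{matrix}\right)=R_m(a,b,c,e,f)\,{}_{4}F_3\!\left(\begin{matrix}a,b,c,f+1\\ b+1,e,f\end{matrix}\right)+Q_m(a,b,c,e,f)\,\frac{\Gamma(e)\Gamma(e-a-c-1)}{\Gamma(e-a)\Gamma(e-c)}. $$ The functions $R_m$, $Q_m$ can be computed recursively, for $m\ge 2$, by $$ R_m=-\frac{B(m-2)}{A(m-2)}R_{m-1}-\frac{C(m-2)}{A(m-2)}R_{m-2},\qquad Q_m=-\frac{B(m-2)}{A(m-2)}Q_{m-1}-\frac{C(m-2)}{A(m-2)}Q_{m-2}, $$ with initial values $R_0=0$, $R_1=1$, $Q_0=e-a-c-1+ac/f$, $Q_1=0$, where $$ A(k)=-\frac{\alpha_k(k+1)(b-a+k+1)(b-c+k+1)}{b+k+1}, $$ $$ \begin{aligned} B(k)={}&\beta_k(b-a+k)(b-f+k+1)(e-a-c+k)\\ &+\big((k+1)(a-f)(b-c+k+1)-a(a-e+1)(b-f+k+1)\big)\big(\beta_k+k(b-c+k)\big), \end{aligned} $$ $$ C(k)=-\alpha_{k+1}(b+k)(e-a-c-1+k), $$ with $$ \alpha_k=(b-f)[a(c-f)+f(e-c-1)]+kf(e-f-1),\qquad \beta_k=a(c-k)+f(e-a-c-1+k). $$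
   Context: Notation: $(x)_0=1$, $(x)_n=x(x+1)\cdots(x+n-1)$ is the rising factorial, and the hypergeometric function is evaluated at unit argument, which is omitted from the notation: $$ {}_4F_3\!\left(\begin{array}{c} a_1,a_2,a_3,a_4\\ b_1,b_2,b_3\end{array}\right)=\sum_{n=0}^\infty \frac{(a_1)_n(a_2)_n(a_3)_n(a_4)_n}{(b_1)_n(b_2)_n(b_3)_n\,n!} $$ (no lower parameter is a non-positive integer). The parameters $a,b,c,e,f$ are complex. Standing convention: the parameters are assumed to be chosen so that all infinite series in the statement converge and the rational and gamma functions appearing in the formulas do not become infinite (all denominators are nonzero). *)

(* Defs.v *)
From HB Require Import structures.
From mathcomp Require Import all_boot all_order all_algebra fraction.
From mathcomp Require Import complex.
From mathcomp Require Import boolp classical_sets reals topology normedtype.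
From mathcomp Require Import sequences exp trigo.
(* The notations of mpoly clash with those of the analysis library. *)
From mathcomp Require Import -(notations) mpoly.

Set Implicit Arguments.
Unset Strict Implicit.
Unset Printing Implicit Defensive.

Import Order.TTheory GRing.Theory Num.Theory numFieldNormedType.Exports.

Local Open Scope ring_scope.
Local Open Scope classical_set_scope.

Definition nonpos_int (K : nzRingType) (x : K) : Prop :=
  exists n : nat, x = - n%:R.

Definition rising (K : nzRingType) (x : K) (n : nat) : K :=
  \prod_(i < n) (x + i%:R).

(* [ps] and [qs] are the upper and lower parameters; the argument is 1. *)
Definition hyp_term (K : fieldType) (ps qs : seq K) (n : nat) : K :=
  (\prod_(p <- ps) rising p n) / ((\prod_(q <- qs) rising q n) * n`!%:R).

Definition hyp_cvg (K : numFieldType) (ps qs : seq K) : Prop :=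
  cvgn (series (hyp_term ps qs)).

(* Ordinary (not necessarily absolute) convergence; the value is meaningful
   only under [hyp_cvg]. *)
Definition hypF (K : numFieldType) (ps qs : seq K) : K :=
  limn (series (hyp_term ps qs)).

Section ComplexGamma.
Variable R : realType.

Definition expC (z : R[i]) : R[i] :=
  ((expR (complex.Re z) * cos (complex.Im z))
     +i* (expR (complex.Re z) * sin (complex.Im z)))%C.

(* n ^ z for an integer n > 0, with the principal logarithm *)
Definition natpowC (n : nat) (z : R[i]) : R[i] :=
  expC (z * ((ln (n%:R : R))%:C)%C).

(* Gauss's formula Gamma(z) = lim n! n^z / (z (z+1) ... (z+n)), which holds
   on the whole domain of Gamma, i.e. for z not a non-positive integer. *)
Definition GammaC (z : R[i]) : R[i] :=
  limn ((fun n => n`!%:R * natpowC n z / rising z n.+1) : nat -> R[i]^o).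

End ComplexGamma.

(* The coefficients are defined over any field, so that they can be read both
   over the field of rational functions and at a complex point. *)
Section Coefficients.
Variable K : fieldType.
Implicit Types (k : nat) (a b c e f : K).

Definition cfalpha k a b c e f : K :=
  (b - f) * (a * (c - f) + f * (e - c - 1)) + k%:R * f * (e - f - 1).

Definition cfbeta k a b c e f : K :=
  a * (c - k%:R) + f * (e - a - c - 1 + k%:R).

Definition cfA k a b c e f : K :=
  - (cfalpha k a b c e f * (k%:R + 1) * (b - a + k%:R + 1)
       * (b - c + k%:R + 1) / (b + k%:R + 1)).

Definition cfB k a b c e f : K :=
  cfbeta k a b c e f * (b - a + k%:R) * (b - f + k%:R + 1)
    * (e - a - c + k%:R)
  + ((k%:R + 1) * (a - f) * (b - c + k%:R + 1)
       - a * (a - e + 1) * (b - f + k%:R + 1))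
    * (cfbeta k a b c e f + k%:R * (b - c + k%:R)).

Definition cfC k a b c e f : K :=
  - (cfalpha k.+1 a b c e f * (b + k%:R) * (e - a - c - 1 + k%:R)).

Definition ABC_rec a b c e f (u : nat -> K) : Prop :=
  forall m, (2 <= m)%N ->
    u m = - (cfB (m - 2) a b c e f / cfA (m - 2) a b c e f) * u (m - 1)%N
          - cfC (m - 2) a b c e f / cfA (m - 2) a b c e f * u (m - 2)%N.

End Coefficients.

Notation ratfun n K := {fraction (mpoly n K)}.

Section RationalFunctions.
Variables (n : nat) (K : fieldType).
Implicit Types (x : ratfun n K) (v : 'I_n -> K).

Definition ratvar (i : 'I_n) : ratfun n K := tofrac (mpolyX K (mnm1 i)).

Definition rat_defined x v : Prop :=
  exists N D : mpoly n K, meval v D != 0 /\ x = tofrac N / tofrac D.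

(* The value of a rational function does not depend on the fraction chosen to
   represent it, see [rat_evalE]; it is 0 by convention at undefined points. *)
Definition rat_eval x v : K :=
  xget 0 [set y | exists N D : mpoly n K,
    [/\ meval v D != 0, x = tofrac N / tofrac D
      & y = meval v N / meval v D]].

Lemma rat_evalE (N D : mpoly n K) v : meval v D != 0 ->
  rat_eval (tofrac N / tofrac D) v = meval v N / meval v D.
Proof.
move=> D0; rewrite /rat_eval; case: xgetP => [y _ /= | noy]; last first.
  by case: (noy (meval v N / meval v D)); exists N, D.
move=> [N' [D' [D'0 eqND ->]]].
have nz (E : mpoly n K) : meval v E != 0 -> tofrac E != 0.
  by move=> E0; rewrite tofrac_eq0; apply: contra_neq E0 => ->; rewrite meval0.
apply/eqP; move/eqP: eqND.
rewrite (eqr_div _ _ (nz _ D0) (nz _ D'0)) (eqr_div _ _ D'0 D0).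
by rewrite -!tofracM tofrac_eq -!mevalM => /eqP ->.
Qed.

End RationalFunctions.

Definition point5 (K : fieldType) (a b c e f : K) (i : 'I_5) : K :=
  nth 0 [:: a; b; c; e; f] i.

Definition ratvar5 (K : fieldType) (j : nat) : ratfun 5 K :=
  ratvar K (inord j : 'I_5).

(* Main.v *)
Require Import Defs.
From mathcomp Require Import all_boot all_order all_algebra fraction.
From mathcomp Require Import complex.
From mathcomp Require Import boolp classical_sets reals topology normedtype.
From mathcomp Require Import sequences exp trigo.
From mathcomp Require Import -(notations) mpoly.
From mathcomp Require Import functions derive ring lra.

Set Implicit Arguments.
Unset Strict Implicit.
Unset Printing Implicit Defensive.

Import Order.TTheory GRing.Theory Num.Theory numFieldNormedType.Exports.
Local Open Scope ring_scope.

(** Write F_k for the series with lower parameter b + k, s = e - a - c, and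
    let g_n = (a)_n (c)_n / ((e)_n n!) be the term of the Gauss series.

    Suppose first that b is not 0.  The n-th term of F_k is
    g_n (f + n) / f * (b)_k / (b + n)_k, so the terms of F_k, F_{k+1}, F_{k+2}
    are rational multiples of one another, and the combination of them with
    coefficients C(k), B(k), A(k) is the difference of an explicit
    hypergeometric sequence ([cert_identity], [cert_telescope]).  Summing over n
    gives the three-term recurrence A F_{k+2} + B F_{k+1} + C F_k = 0 for k >= 1
    ([F43_recurrenceS]).  For k = 0 the series F_0 need not converge; the part of
    the boundary term that does not vanish is exactly what turns C(0) F_0 into a
    multiple of the Gauss series ([cert0_telescope], [F43_recurrence0]), and the
    Gauss summation theorem ([gauss_sum]) gives its value.  Hence the sequence
    u_0 = Q_0 G, u_k = F_k for k >= 1, where G is the quotient of Gamma values,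
    solves the recurrence, and R_m, Q_m are the coordinates of u_m with respect
    to u_1 and G ([rec_sol_linear]).  If b = 0, every F_k with k >= 1 equals 1,
    and the recurrence is the certificate at n = 0.

    Only the convergence of F_1, possibly conditional, is available.  Abel
    summation ([cvg_series_div_natrD]) carries it to F_2, F_3, ..., to the sum of
    the g_n, and to the existence of the limit of n g_n; this limit is 0 because
    the harmonic series diverges ([cvg_series_natrM_limit0]).  That n g_n tends
    to 0 is all that the vanishing of the boundary terms requires, and the
    argument does not distinguish terminating series from those with Re s > 0.

    The Gauss theorem comes from the contiguous relation between the sums at e
    and e + 1, iterated ([gauss_iterate]): the sum at e + N tends to 1, and the
    finite product in front of it tends to the quotient of Gamma values by the
    limit formula that defines Gamma.  That this limit exists and is nonzero
    follows from successive ratios being 1 + O(1/n^2)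
    ([cvg_quadratic_ratio_neq0], [cvg_gamma_seq]).

    The argument on series is written over an abstract field in which 1/n tends
    to 0 and a sequence with O(1/n^2) increments converges; the complex numbers
    satisfy both ([complex_cvg_harmonic], [complex_quadratic_complete]). *)

(** * Values of rational functions *)

Section RationalValues.
Variables (n : nat) (K : fieldType).
Implicit Types (x y : ratfun n K) (v : 'I_n -> K).

(** Says both that x is defined at v and that its value is z: unlike [rat_eval],
    which is 0 at undefined points, this relation respects field operations. *)
Definition has_value v x (z : K) : Prop :=
  exists N D : mpoly n K,
    [/\ meval v D != 0, x = tofrac N / tofrac D & z = meval v N / meval v D].

Lemma has_value_defined v x z : has_value v x z -> rat_defined x v.
Proof. by case=> N [D [D0 -> _]]; exists N, D. Qed.

Lemma has_value_eval v x z : has_value v x z -> rat_eval x v = z.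
Proof. by case=> N [D [D0 -> ->]]; rewrite rat_evalE. Qed.

Lemma tofrac_neq0 v (D : mpoly n K) : meval v D != 0 -> tofrac D != 0.
Proof. by move=> D0; rewrite tofrac_eq0; apply: contra_neq D0 => ->; rewrite meval0. Qed.

Lemma has_value_poly v (p : mpoly n K) : has_value v (tofrac p) (meval v p).
Proof. by exists p, 1; rewrite meval1 tofrac1 !divr1 oner_eq0. Qed.

Lemma has_valueD v x y z t :
  has_value v x z -> has_value v y t -> has_value v (x + y) (z + t).
Proof.
move=> [N [D [D0 -> ->]]] [N' [D' [D0' -> ->]]].
exists (N * D' + N' * D), (D * D'); rewrite mevalD !mevalM mulf_neq0 //.
by rewrite tofracD !tofracM !addf_div //; apply: tofrac_neq0; eassumption.
Qed.

Lemma has_valueN v x z : has_value v x z -> has_value v (- x) (- z).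
Proof.
by move=> [N [D [D0 -> ->]]]; exists (- N), D; rewrite mevalN tofracN !mulNr.
Qed.

Lemma has_valueB v x y z t :
  has_value v x z -> has_value v y t -> has_value v (x - y) (z - t).
Proof. by move=> xz yt; apply: has_valueD => //; apply: has_valueN. Qed.

Lemma has_valueM v x y z t :
  has_value v x z -> has_value v y t -> has_value v (x * y) (z * t).
Proof.
move=> [N [D [D0 -> ->]]] [N' [D' [D0' -> ->]]].
exists (N * N'), (D * D'); rewrite !mevalM mulf_neq0 //.
by rewrite !tofracM !mulf_div.
Qed.

Lemma has_valueV v x z : z != 0 -> has_value v x z -> has_value v x^-1 z^-1.
Proof.
move=> z0 [N [D [D0 -> zE]]]; exists D, N; rewrite zE !invf_div; split=> //.
by apply: contraNneq z0 => N0; rewrite zE N0 mul0r.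
Qed.

Lemma has_value_div v x y z t : t != 0 ->
  has_value v x z -> has_value v y t -> has_value v (x / y) (z / t).
Proof. by move=> t0 xz yt; apply: has_valueM => //; apply: has_valueV. Qed.

Lemma has_value_nat v k : has_value v k%:R k%:R.
Proof. by have := has_value_poly v k%:R; rewrite !rmorph_nat. Qed.

Lemma has_value0 v : has_value v 0 0. Proof. exact: (has_value_nat v 0). Qed.
Lemma has_value1 v : has_value v 1 1. Proof. exact: (has_value_nat v 1). Qed.

Lemma has_value_var v i : has_value v (ratvar K i) (v i).
Proof. by have := has_value_poly v (mpolyX K (mnm1 i)); rewrite mevalXU. Qed.

End RationalValues.

Lemma has_value_var5 (K : fieldType) (a b c e f : K) (j : nat) : (j < 5)%N ->
  has_value (point5 a b c e f) (ratvar5 K j) (nth 0 [:: a; b; c; e; f] j).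
Proof.
by move=> j5; have := has_value_var (point5 a b c e f) (inord j); rewrite /point5 inordK.
Qed.

Section Coefficients.
Variables (n : nat) (K : fieldType) (v : 'I_n -> K).
Variables (A B C E F : ratfun n K) (a b c e f : K).
Hypotheses (hA : has_value v A a) (hB : has_value v B b) (hC : has_value v C c).
Hypotheses (hE : has_value v E e) (hF : has_value v F f).

Ltac has_value_tac := repeat first
  [ eassumption | exact: has_value_nat | exact: has_value1
  | apply: has_valueB | apply: has_valueD | apply: has_valueN | apply: has_valueM ].

Lemma has_value_alpha k :
  has_value v (cfalpha k A B C E F) (cfalpha k a b c e f).
Proof. rewrite /cfalpha; has_value_tac. Qed.

Lemma has_value_beta k :
  has_value v (cfbeta k A B C E F) (cfbeta k a b c e f).
Proof. rewrite /cfbeta; has_value_tac. Qed.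

Lemma has_value_A k : b + k%:R + 1 != 0 ->
  has_value v (cfA k A B C E F) (cfA k a b c e f).
Proof.
move=> bk; rewrite /cfA; apply/has_valueN/has_value_div => //; last has_value_tac.
have := has_value_alpha k => ?; has_value_tac.
Qed.

Lemma has_value_B k :
  has_value v (cfB k A B C E F) (cfB k a b c e f).
Proof. have := has_value_beta k => ?; rewrite /cfB; has_value_tac. Qed.

Lemma has_value_C k :
  has_value v (cfC k A B C E F) (cfC k a b c e f).
Proof. have := has_value_alpha k.+1 => ?; rewrite /cfC; has_value_tac. Qed.

End Coefficients.

Section RecursiveSolution.
Variables (K : fieldType) (a b c e f : K).

(** The recurrence has order two, so two consecutive values are carried along. *)
Fixpoint rec_pair (u0 u1 : K) (m : nat) : K * K :=
  if m is k.+1 then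
    let: (x, y) := rec_pair u0 u1 k in
    (y, - (cfB k a b c e f / cfA k a b c e f) * y
        - cfC k a b c e f / cfA k a b c e f * x)
  else (u0, u1).

Definition rec_sol u0 u1 m := (rec_pair u0 u1 m).1.

Lemma rec_solSS u0 u1 k : rec_sol u0 u1 k.+2 =
  - (cfB k a b c e f / cfA k a b c e f) * rec_sol u0 u1 k.+1
  - cfC k a b c e f / cfA k a b c e f * rec_sol u0 u1 k.
Proof. by rewrite /rec_sol /=; case: (rec_pair u0 u1 k). Qed.

Lemma rec_sol_ABC u0 u1 : ABC_rec a b c e f (rec_sol u0 u1).
Proof. by case=> [|[|k]] // _; rewrite rec_solSS !subSS subn0. Qed.

End RecursiveSolution.

(** The solution over the function field is evaluated step by step: the only
    divisions are by b + k + 1 and A(k) with k <= m - 2. *)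
Lemma has_value_rec_sol (n : nat) (K : fieldType) (v : 'I_n -> K)
    (A B C E F U0 U1 : ratfun n K) (a b c e f u0 u1 : K) :
    has_value v A a -> has_value v B b -> has_value v C c ->
    has_value v E e -> has_value v F f ->
    has_value v U0 u0 -> has_value v U1 u1 ->
  forall m,
    (forall k, (k.+1 < m)%N -> b + k%:R + 1 != 0 /\ cfA k a b c e f != 0) ->
  has_value v (rec_sol A B C E F U0 U1 m) (rec_sol a b c e f u0 u1 m).
Proof.
move=> hA hB hC hE hF hU0 hU1 m.
have [k] := ubnP m; elim: k m => // k IH [|[|m]] // mk nz.
have [bm Am] := nz m (ltnSn _).
rewrite !rec_solSS; apply: has_valueB; apply: has_valueM.
- by apply/has_valueN/has_value_div; [|exact: has_value_B|exact: has_value_A].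
- by apply: IH => // j jm; apply: nz; exact: ltnW.
- by apply: has_value_div; [|exact: has_value_C|exact: has_value_A].
- by apply: IH => [|j jm]; [exact: ltnW|apply: nz; exact: ltnW (ltnW _)].
Qed.

(** * Rising factorials and hypergeometric terms *)

Section Rising.
Variable K : fieldType.
Implicit Types (x : K) (ps qs : seq K).

Lemma rising0 x : rising x 0 = 1.
Proof. by rewrite /rising big_ord0. Qed.

Lemma risingS x n : rising x n.+1 = rising x n * (x + n%:R).
Proof. by rewrite /rising big_ord_recr. Qed.

Lemma rising_shift x n : rising x n.+1 = x * rising (x + 1) n.
Proof.
rewrite /rising big_ord_recl addr0; congr (_ * _); apply: eq_bigr => i _.
by rewrite lift0 -addrA nat1r.
Qed.

Lemma risingD x m n : rising x (m + n) = rising x m * rising (x + m%:R) n.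
Proof.
elim: n => [|n IH]; first by rewrite addn0 rising0 mulr1.
by rewrite addnS !risingS IH mulrA natrD addrA.
Qed.

Lemma nonpos_intD x k : ~ nonpos_int x -> ~ nonpos_int (x + k%:R).
Proof.
by move=> hx [n xk]; apply: hx; exists (n + k)%N; rewrite natrD opprD -xk addrK.
Qed.

Lemma nonpos_int_neq0 x n : ~ nonpos_int x -> x + n%:R != 0.
Proof.
by move=> hx; apply/eqP => /eqP; rewrite addr_eq0 => /eqP xn; apply: hx; exists n.
Qed.

Lemma rising_neq0 x n : ~ nonpos_int x -> rising x n != 0.
Proof. by move=> hx; apply/prodf_neq0 => i _; exact: nonpos_int_neq0. Qed.

Lemma hyp_term0 ps qs : hyp_term ps qs 0 = 1.
Proof.
rewrite /hyp_term !big1 ?mulr1 ?divr1// => x _; exact: rising0.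
Qed.

Lemma hyp_termS ps qs n : hyp_term ps qs n.+1 = hyp_term ps qs n *
  ((\prod_(p <- ps) (p + n%:R)) / ((\prod_(q <- qs) (q + n%:R)) * n.+1%:R)).
Proof.
rewrite /hyp_term factS natrM.
under eq_bigr do rewrite risingS.
under [X in _ / (X * _)]eq_bigr do rewrite risingS.
by rewrite !big_split /= mulf_div; congr (_ / _); ring.
Qed.

End Rising.
Arguments rising_neq0 [K x].
Arguments nonpos_int_neq0 [K x].

(** * Sequences and series in a numeric field *)

(** The only form of completeness that is used.  It passes to the complex
    numbers through real and imaginary parts, without any uniform structure
    on them. *)
Definition quadratic_complete (K : numFieldType) : Prop :=
  forall (u : nat -> K) (M : K),
    (forall n, `|u n.+1 - u n| <= M / n.+1%:R ^+ 2) -> cvgn u.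

Section Sequences.
Local Open Scope classical_set_scope.
Variable K : numFieldType.
Hypothesis K_complete : quadratic_complete K.
Hypothesis K_harmonic : @harmonic K @ \oo --> 0.
Implicit Types (u v : nat -> K) (x y l : K).

Lemma cvgn_bounded u : cvgn u -> exists2 M : K, 0 < M & forall n, `|u n| <= M.
Proof.
move=> /cvg_seq_bounded/pinfty_ex_gt0[M M0 uM].
by exists M => // n; exact: uM.
Qed.

Lemma natr1D_neq0 n : n%:R + 1 != 0 :> K.
Proof. by rewrite natr1 pnatr_eq0. Qed.

(** Limits and bounds for n + y reduce to those of the harmonic sequence. *)
Lemma natrDE n y : n%:R + y = n.+1%:R * (1 + (y - 1) * harmonic n).
Proof. by rewrite /harmonic /= -natr1; field; exact: natr1D_neq0. Qed.

Lemma cvg_natrD_factor y : (fun n => 1 + (y - 1) * harmonic n : K) @ \oo --> (1 : K).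
Proof.
have : (fun n => 1 + (y - 1) * harmonic n : K) @ \oo --> (1 + (y - 1) * 0 : K).
  by apply: cvgD; [exact: cvg_cst|apply: cvgM => //; exact: cvg_cst].
by rewrite mulr0 addr0.
Qed.

Lemma cvg_inv_natrD y : (fun n => (n%:R + y)^-1) @ \oo --> (0 : K).
Proof.
under eq_fun => n do rewrite natrDE invfM.
suff : (fun n => harmonic n * (1 + (y - 1) * harmonic n)^-1 : K) @ \oo --> (0 * 1^-1 : K)
  by rewrite mul0r.
apply: cvgM => //.
by apply: cvgV; [exact: oner_neq0|exact: cvg_natrD_factor].
Qed.

Lemma cvg_ratio_natrD x y : (fun n => (n%:R + x) / (n%:R + y)) @ \oo --> (1 : K).
Proof.
under eq_fun => n do rewrite (natrDE n x) (natrDE n y) -mulf_div divff ?pnatr_eq0// mul1r.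
suff : (fun n => (1 + (x - 1) * harmonic n) * (1 + (y - 1) * harmonic n)^-1 : K)
    @ \oo --> (1 * 1^-1 : K) by rewrite divr1.
apply: cvgM; first exact: cvg_natrD_factor.
by apply: cvgV; [exact: oner_neq0|exact: cvg_natrD_factor].
Qed.

Lemma inv_natrD_bound y :
  exists2 M : K, 0 < M & forall n, `|(n%:R + y)^-1| <= M / n.+1%:R.
Proof.
have /cvgn_bounded[M M0 uM] : cvgn (fun n => (n%:R + 1) / (n%:R + y) : K).
  by apply: cvgP; exact: cvg_ratio_natrD.
exists M => // n; have := uM n; rewrite normrM natr1 normr_nat.
by rewrite ler_pdivlMr ?ltr0n// mulrC.
Qed.

Lemma natr_norm_bound (x : K) : exists N : nat, `|x| <= N%:R.
Proof.
have x1 : 0 < (`|x| + 1)^-1 by rewrite invr_gt0 ltr_wpDl.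
have /cvgrPdist_lt/(_ _ x1)[N _ /(_ N (leqnn N))] := K_harmonic.
rewrite sub0r normrN normfV normr_nat ltf_pV2 ?posrE ?ltr0n ?ltr_wpDl// => xN.
by exists N.+1; rewrite (le_trans _ (ltW xN))// lerDl.
Qed.

(** With y_n = 2 M / (n + 1), which dominates the remaining sum of the
    M / (k + 1)^2, the sequence |u_n| (1 + 2 y_n) eventually decreases.
    Hence u is bounded and its increments are O(1/n^2). *)
Lemma cvg_quadratic_ratio u (M : K) N0 : 0 <= M ->
    (forall n, (N0 <= n)%N -> `|u n.+1 - u n| <= `|u n| * (M / n.+1%:R ^+ 2)) ->
  cvgn u.
Proof.
move=> M0 uM; have [N1 hN1] := natr_norm_bound (4 * M).
pose N := maxn N0 N1; pose y n : K := 2 * M / n.+1%:R.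
have y0 k : 0 <= y k by rewrite /y divr_ge0 // mulr_ge0.
have yM k : M / k.+1%:R ^+ 2 <= y k - y k.+1.
  rewrite /y -mulrBr -subr_ge0.
  have n1 : k%:R + 1 != 0 :> K by rewrite natr1 pnatr_eq0.
  have n2 : k%:R + 2 != 0 :> K by rewrite -natrD addn2 pnatr_eq0.
  have -> : 2 * M * (k.+1%:R^-1 - k.+2%:R^-1) - M / k.+1%:R ^+ 2 =
      M * k%:R / ((k%:R + 1) ^+ 2 * (k%:R + 2)).
    by rewrite -[k.+2]addn2 -[k.+1]addn1 !natrD; field; rewrite n1 n2.
  by rewrite divr_ge0 ?mulr_ge0 // ?exprn_ge0 // ?addr_ge0.
have y_decr k : 0 <= y k - y k.+1 by rewrite (le_trans _ (yM k))// divr_ge0 // exprn_ge0.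
have y2 k : (N <= k)%N -> 0 <= 1 - 2 * y k.
  move=> Nk; rewrite subr_ge0 /y mulrA mulrA -natrM ler_pdivrMr ?ltr0n // mul1r.
  rewrite -[_ * M]ger0_norm ?mulr_ge0 // (le_trans hN1)// ler_nat.
  by rewrite (leq_trans _ (leqW Nk)) // leq_maxr.
have uB k : (N <= k)%N -> `|u k| * (1 + 2 * y k) <= `|u N| * (1 + 2 * y N).
  elim: k => [|k IH]; first by rewrite leqn0 => /eqP <-.
  rewrite leq_eqVlt => /orP[/eqP <-//|]; rewrite ltnS => Nk.
  apply: le_trans (IH Nk).
  have uk : `|u k.+1| <= `|u k| * (1 + (y k - y k.+1)).
    rewrite -[u k.+1](subrK (u k)) (le_trans (ler_normD _ _))// addrC mulrDr mulr1 lerD2l.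
    by rewrite (le_trans (uM _ (leq_trans (leq_maxl _ _) Nk)))// ler_wpM2l.
  have y1 : 0 <= 1 + 2 * y k.+1 by rewrite addr_ge0 // mulr_ge0.
  rewrite (le_trans (ler_wpM2r y1 uk))// -mulrA ler_wpM2l // -subr_ge0.
  have -> : 1 + 2 * y k - (1 + (y k - y k.+1)) * (1 + 2 * y k.+1) =
      (y k - y k.+1) * (1 - 2 * y k.+1) by ring.
  by rewrite mulr_ge0 // y2 // leqW.
pose B := `|u N| * (1 + 2 * y N).
have {uB} uB k : (N <= k)%N -> `|u k| <= B.
  move=> Nk; rewrite (le_trans _ (uB k Nk))// ler_peMr // lerDl mulr_ge0 //.
suff /cvg_ex[l cl] : cvgn (fun n => u (n + N)%N).
  by apply/cvg_ex; exists l; rewrite -(cvg_shiftn N).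
have B0 : 0 <= B by rewrite (le_trans _ (uB N (leqnn N))).
apply: (K_complete (M := B * M)) => n /=; rewrite addSn.
have Nn : (N <= n + N)%N by rewrite leq_addl.
rewrite (le_trans (uM _ (leq_trans (leq_maxl _ _) Nn)))// -mulrA ler_pM ?uB //.
  by rewrite divr_ge0 // exprn_ge0.
rewrite ler_wpM2l // lef_pV2 ?posrE ?exprn_gt0 ?ltr0n //.
by rewrite ler_pXn2r ?nnegrE // ler_nat ltnS leq_addr.
Qed.

(** The sequence of inverses converges too, and the product of the two limits
    is 1. *)
Lemma cvg_quadratic_ratio_neq0 u (M M' : K) N0 N0' : 0 <= M -> 0 <= M' ->
    (forall n, u n != 0) ->
    (forall n, (N0 <= n)%N -> `|u n.+1 - u n| <= `|u n| * (M / n.+1%:R ^+ 2)) ->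
    (forall n, (N0' <= n)%N ->
      `|(u n.+1)^-1 - (u n)^-1| <= `|(u n)^-1| * (M' / n.+1%:R ^+ 2)) ->
  exists2 l, l != 0 & u @ \oo --> l.
Proof.
move=> M0 M0' u0 uM uM'.
have /cvg_ex[l cl] := cvg_quadratic_ratio M0 uM.
have /cvg_ex[l' cl'] := cvg_quadratic_ratio M0' uM'.
exists l => //; apply/eqP => l0.
have := oner_neq0 K; rewrite -[0](mul0r l') -l0 => /eqP; apply.
have h1 : (fun n => u n * (u n)^-1) @ \oo --> (1 : K).
  by under eq_fun do rewrite divff //; exact: cvg_cst.
have h : (fun n => u n * (u n)^-1) @ \oo --> l * l' by exact: cvgM.
exact: cvg_unique h1 h.
Qed.

(** Summation by parts: the partial sums are bounded, and 1 / (n + y) has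
    increments O(1/n^2). *)
Lemma cvg_series_div_natrD u y : ~ nonpos_int y ->
  cvgn (series u) -> cvgn (series (fun n => u n / (n%:R + y))).
Proof.
move=> hy cu.
have [MU MU0 hU] := cvgn_bounded cu.
have [M M0 hM] := inv_natrD_bound y.
pose r n : K := (n%:R + y)^-1.
pose D n : K := series (fun n => u n * r n) n - series u n * r n.
have cD : cvgn D.
  apply: (K_complete (M := MU * (M * M))) => n.
  have -> : D n.+1 - D n = series u n.+1 * (r n * r n.+1).
    rewrite /D !seriesSr /= /r.
    have := nonpos_int_neq0 n hy; have := nonpos_int_neq0 n.+1 hy.
    by rewrite ![y + _]addrC -natr1 => h1 h2; field; rewrite h1 h2.
  rewrite !normrM -mulrA expr2.
  have n2n : M / n.+2%:R <= M / n.+1%:R.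
    by rewrite ler_pM2l // lef_pV2 ?posrE ?ltr0n// ler_nat.
  apply: ler_pM => //; first by rewrite mulr_ge0.
  have -> : M * M / (n.+1%:R * n.+1%:R) = M / n.+1%:R * (M / n.+1%:R).
    by rewrite mulf_div.
  by apply: ler_pM => //; [exact: hM|exact: le_trans (hM _) _].
have -> : series (fun n => u n / (n%:R + y)) = (fun n => D n + series u n * r n).
  by apply/funext => n; rewrite /D subrK.
by apply: is_cvgD => //; apply: is_cvgM => //; apply: cvgP; exact: cvg_inv_natrD.
Qed.

(** Otherwise u_n is close to l / n, and the blocks from n to 2 n do not tend
    to 0, as for the harmonic series. *)
Lemma cvg_series_natrM_limit0 u l :
  cvgn (series u) -> (fun n => n%:R * u n) @ \oo --> l -> l = 0.
Proof.
move=> cu nul; apply/eqP; apply: contraT => l0.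
have nl : 0 < `|l| / 4 by rewrite divr_gt0 ?normr_gt0.
have /cvgrPdist_lt/(_ _ nl)[N _ hN] := nul.
have /cvg_cauchy/cauchy_seriesP/(_ _ nl) := cu.
move=> [[P Q] /= [[a _ aP] [b _ bQ]] PQ].
pose n := maxn N.+1 (maxn a b).
have nN : (N <= n)%N by rewrite /n leq_max leqnSn.
have n0 : (0 < n)%N by rewrite /n leq_max.
have na : (a <= n)%N by rewrite /n !leq_max leqnn orbT.
have nb : (b <= n.*2)%N.
  by rewrite -addnn (leq_trans _ (leq_addr _ _))// /n !leq_max leqnn !orbT.
have := PQ (n, n.*2) (conj (aP _ na) (bQ _ nb)) => /=.
(* On [n, 2n) the sum of 1/k lies between 1/2 and 1, and k u_k is within
   |l| / 4 of l. *)
suff : `|l| / 4 <= `|\sum_(n <= k < n.*2) u k| by move=> /le_gtF ->.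
pose H : K := \sum_(n <= k < n.*2) k%:R^-1.
have H0 : 0 <= H by apply: sumr_ge0 => k _; rewrite invr_ge0.
have H2 : 2^-1 <= H.
  rewrite (@le_trans _ _ (\sum_(n <= i < n.*2) n.*2%:R^-1)) //=.
    rewrite sumr_const_nat -addnn addnK addnn -mul2n natrM invfM.
    by rewrite -[_ *+ n]mulr_natr divfK // pnatr_eq0 -lt0n.
  apply: ler_sum_nat => i /andP[ni i2]; rewrite lef_pV2 ?posrE ?ltr0n ?ler_nat.
  - exact: ltnW.
  - by rewrite double_gt0.
  - exact: leq_trans ni.
have H1 : H <= 1.
  rewrite (@le_trans _ _ (\sum_(n <= i < n.*2) n%:R^-1)) //=.
    apply: ler_sum_nat => i /andP[ni i2]; rewrite lef_pV2 ?posrE ?ltr0n ?ler_nat //.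
    exact: leq_trans ni.
  rewrite sumr_const_nat -addnn addnK.
  by rewrite -[_ *+ n]mulr_natr mulVf // pnatr_eq0 -lt0n.
have hd : `|l * H - \sum_(n <= k < n.*2) u k| <= `|l| / 4.
  rewrite /H mulr_sumr -sumrB (le_trans (ler_norm_sum _ _ _))//.
  rewrite (@le_trans _ _ (\sum_(n <= k < n.*2) `|l| / 4 * k%:R^-1)) //; last first.
    by rewrite -mulr_sumr -/H -[leRHS]mulr1 ler_pM2l.
  apply: ler_sum_nat => k /andP[nk _].
  have k0 : 0 < k%:R :> K by rewrite ltr0n (leq_trans n0).
  have -> : l / k%:R - u k = (l - k%:R * u k) / k%:R.
    by field; rewrite gt_eqF.
  rewrite normrM normfV normr_nat ler_pM2r ?invr_gt0//.
  exact/ltW/(hN k)/(leq_trans nN).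
have hl : `|l| / 2 <= `|l * H|.
  by rewrite normrM (ger0_norm H0) ler_pM2l // normr_gt0.
have -> : \sum_(n <= k < n.*2) u k = l * H - (l * H - \sum_(n <= k < n.*2) u k).
  by rewrite subKr.
apply: le_trans (lerB_dist _ _).
have -> : `|l| / 4 = `|l| / 2 - `|l| / 4 by field.
by apply: lerB.
Qed.

End Sequences.

Section Limits.
Local Open Scope classical_set_scope.
Variable K : numFieldType.
Implicit Types (u v G : nat -> K).

Lemma cvg_dominated u v (l : K) :
  (\forall n \near \oo, `|u n - l| <= v n) -> v @ \oo --> (0 : K) -> u @ \oo --> l.
Proof.
move=> uv v0; apply/cvgrPdist_lt => e e0.
have /cvgrPdist_lt/(_ _ e0) := v0; move: uv.
apply: filterS2 => n uvn; rewrite sub0r normrN distrC; apply: le_lt_trans.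
by rewrite (le_trans uvn)// real_ler_norm// ger0_real// (le_trans _ uvn).
Qed.

Lemma cvg_series_telescope u G : (forall n, u n = G n.+1 - G n) ->
  forall l : K, G @ \oo --> l -> series u @ \oo --> l - G 0%N.
Proof.
move=> uG l Gl; have -> : series u = (fun n => G n - G 0%N).
  apply/funext => n; rewrite -[LHS]/(\sum_(0 <= k < n) u k).
  by rewrite (eq_bigr _ (fun k _ => uG k)) telescope_sumr.
by apply: cvgB => //; exact: cvg_cst.
Qed.

Lemma cvg_seriesM u (x l : K) : series u @ \oo --> l ->
  series (fun n => x * u n) @ \oo --> x * l.
Proof.
move=> ul; have -> : series (fun n => x * u n) = (fun n => x * series u n).
  by apply/funext => n; rewrite /series /= mulr_sumr.
by apply: cvgM => //; exact: cvg_cst.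
Qed.

Lemma cvg_seriesD u v (l m : K) : series u @ \oo --> l -> series v @ \oo --> m ->
  series (fun n => u n + v n) @ \oo --> l + m.
Proof. by move=> ul vm; rewrite (seriesD u v); exact: cvgD. Qed.

Lemma is_cvg_seriesM u (x : K) : cvgn (series u) -> cvgn (series (fun n => x * u n)).
Proof. by move=> cu; apply: cvgP; exact: cvg_seriesM cu. Qed.

Lemma is_cvg_series_add u v : cvgn (series u) -> cvgn (series v) ->
  cvgn (series (fun n => u n + v n)).
Proof. by move=> cu cv; apply: cvgP; exact: cvg_seriesD cu cv. Qed.

Lemma sum_inv_sqr_le2 n : \sum_(0 <= k < n) (k.+1%:R ^+ 2)^-1 <= 2 :> K.
Proof.
suff /le_trans : \sum_(0 <= k < n) (k.+1%:R ^+ 2)^-1 <= 2 - 2 / n.+1%:R :> K.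
  by apply; rewrite gerBl divr_ge0.
elim: n => [|n IH]; first by rewrite big_geq// divr1 subrr.
rewrite big_nat_recr //= (le_trans (lerD IH (lexx _)))// -subr_ge0.
have n1 : n%:R + 1 != 0 :> K by rewrite natr1 pnatr_eq0.
have n2 : n%:R + 2 != 0 :> K by rewrite -natrD pnatr_eq0 addn2.
have -> : 2 - 2 / n.+2%:R - (2 - 2 / n.+1%:R + (n.+1%:R ^+ 2)^-1) =
    n%:R / ((n%:R + 1) ^+ 2 * (n%:R + 2)) :> K.
  by rewrite -[n.+2]addn2 -[n.+1]addn1 !natrD; field; rewrite n1 n2.
by rewrite natr1 -natrD divr_ge0 // mulr_ge0 // exprn_ge0.
Qed.

End Limits.

(** * The Gauss series *)

Section Gauss.
Local Open Scope classical_set_scope.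
Variable K : numClosedFieldType.
Hypothesis K_complete : quadratic_complete K.
Hypothesis K_harmonic : @harmonic K @ \oo --> 0.
Variables a c : K.
Implicit Types e : K.

Definition gauss e := hyp_term [:: a; c] [:: e].

Lemma gauss0 e : gauss e 0 = 1. Proof. exact: hyp_term0. Qed.

Lemma gaussS e n :
  gauss e n.+1 = gauss e n * ((a + n%:R) * (c + n%:R) / ((e + n%:R) * n.+1%:R)).
Proof. by rewrite /gauss hyp_termS !big_cons !big_nil !mulr1. Qed.

Lemma gauss_shift e n : ~ nonpos_int e -> gauss (e + 1) n = gauss e n * (e / (e + n%:R)).
Proof.
move=> he; rewrite /gauss /hyp_term !big_cons !big_nil !mulr1.
have := rising_shift e n; rewrite risingS => rE.
have e0 : e != 0 by have := nonpos_int_neq0 0 he; rewrite addr0.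
have -> : rising (e + 1) n = rising e n * (e + n%:R) / e by rewrite rE mulrC mulKf.
have := nonpos_int_neq0 n he; have := rising_neq0 n he.
have : n`!%:R != 0 :> K by rewrite pnatr_eq0 -lt0n fact_gt0.
by move=> h1 h2 h3; field; rewrite h1 h2 h3.
Qed.

(** What summation of the telescoping identities below requires of the Gauss
    series; it is stable under e -> e + 1. *)
Definition gauss_summable e :=
  cvgn (series (gauss e)) /\ (fun n => n%:R * gauss e n) @ \oo --> (0 : K).

(** The increments of n g_n are rational multiples of g_n that split into terms
    covered by Abel summation. *)
Lemma gauss_telescope e n : ~ nonpos_int e ->
  n.+1%:R * gauss e n.+1 - n%:R * gauss e n
  = - (e - a - c) * gauss e n + (a * c + (e - a - c) * e) * (gauss e n / (n%:R + e)).
Proof.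
move=> he; rewrite gaussS; have en := nonpos_int_neq0 n he.
have n1 : n%:R + 1 != 0 :> K by rewrite natr1 pnatr_eq0.
by rewrite -natr1 [n%:R + e]addrC; field; rewrite ?n1 ?en.
Qed.

(** By [gauss_telescope], n g_n is a convergent series, so it has a limit. *)
Lemma cvg_gauss_summable e : ~ nonpos_int e ->
  cvgn (series (gauss e)) -> gauss_summable e.
Proof.
move=> he cg; split=> //.
pose G n := n%:R * gauss e n.
have cG : cvgn G.
  have -> : G = series (fun n => - (e - a - c) * gauss e n
      + (a * c + (e - a - c) * e) * (gauss e n / (n%:R + e))).
    apply/funext => n; rewrite /series /=.
    under eq_bigr do rewrite -gauss_telescope //.
    by rewrite telescope_sumr // /G mul0r subr0.
  apply: is_cvg_series_add; apply: is_cvg_seriesM => //.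
  exact: cvg_series_div_natrD.
by have <- := cvg_series_natrM_limit0 cg cG.
Qed.

Lemma gauss_summable_shift e : ~ nonpos_int e ->
  gauss_summable e -> gauss_summable (e + 1).
Proof.
move=> he [cg g0]; apply: cvg_gauss_summable.
  exact: (nonpos_intD (k := 1)).
have -> : gauss (e + 1) = (fun n => e * (gauss e n / (n%:R + e))).
  by apply/funext => n; rewrite gauss_shift // [n%:R + e]addrC mulrCA.
by apply: is_cvg_seriesM; exact: cvg_series_div_natrD.
Qed.

(** The termwise difference of the two sides is the increment of - e n g_n. *)
Lemma gauss_contiguous e : ~ nonpos_int e -> gauss_summable e ->
  e * (e - a - c) * limn (series (gauss e))
  = (e - a) * (e - c) * limn (series (gauss (e + 1))).
Proof.
move=> he sg; have [cg g0] := sg; have [cg' _] := gauss_summable_shift he sg.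
apply/eqP; rewrite -subr_eq0; apply/eqP.
have := cvg_seriesD (cvg_seriesM (x := e * (e - a - c)) cg)
  (cvg_seriesM (x := - ((e - a) * (e - c))) cg').
set u := (fun n => _) => cu.
have : series u @ \oo --> - e * 0 - - e * (0%:R * gauss e 0).
  apply: (cvg_series_telescope (G := fun n => - e * (n%:R * gauss e n))).
    move=> n; rewrite -mulrBr gauss_telescope // /u gauss_shift //.
    by have en := nonpos_int_neq0 n he; rewrite [n%:R + e]addrC; field; rewrite ?en.
  by apply: cvgM => //; exact: cvg_cst.
rewrite mul0r !mulr0 subrr => u0.
by rewrite -mulNr; apply: (cvg_unique _ cu u0).
Qed.

Lemma gauss_iterate e N : ~ nonpos_int e -> ~ nonpos_int (e - a - c) ->
    gauss_summable e ->
  limn (series (gauss e)) =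
    rising (e - a) N * rising (e - c) N / (rising e N * rising (e - a - c) N)
    * limn (series (gauss (e + N%:R))) /\ gauss_summable (e + N%:R).
Proof.
move=> he hs sg; elim: N => [|N [-> sgN]].
  by rewrite !rising0 !mulr1 divr1 mul1r addr0.
have heN := nonpos_intD (k := N) he.
rewrite -natr1 addrA; split; last exact: gauss_summable_shift.
have eN := nonpos_int_neq0 N he; have sN := nonpos_int_neq0 N hs.
have rE := rising_neq0 N he; have rS := rising_neq0 N hs.
rewrite !risingS.
have -> : limn (series (gauss (e + N%:R))) =
    (e + N%:R - a) * (e + N%:R - c) / ((e + N%:R) * (e - a - c + N%:R))
    * limn (series (gauss (e + N%:R + 1))).
  apply: (mulfI (mulf_neq0 eN sN)).
  have := gauss_contiguous heN sgN; set X := limn _; set Y := limn _.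
  have -> : e + N%:R - a - c = e - a - c + N%:R by ring.
  by move=> ->; field; rewrite eN sN.
by field; rewrite eN sN rE rS.
Qed.

(** As soon as the real part of e + j is nonnegative, adding n moves the point
    away from 0. *)
Lemma norm_natrD_le e : exists J : nat, forall j n, (J <= j)%N ->
  `|e + j%:R| <= `|e + (j + n)%:R|.
Proof.
have [J eJ] := natr_norm_bound K_harmonic ('Re e); exists J => j n Jj.
rewrite -ler_sqr ?qualifE //= natrD !normC2_Re_Im !raddfD /=.
have ImE k : 'Im (k%:R : K) = 0 by apply/Creal_ImP; exact: realn.
have ReE k : 'Re (k%:R : K) = k%:R by apply/Creal_ReP; exact: realn.
rewrite !ImE !ReE !addr0 lerD2r addrA.
have h0 : 0 <= 'Re e + j%:R.
  rewrite -(opprK ('Re e)) addrC subr_ge0 (le_trans (real_ler_norm _)) ?realN ?Creal_Re //.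
  by rewrite normrN (le_trans eJ)// ler_nat.
have h1 : 0 <= 'Re e + j%:R + n%:R by rewrite addr_ge0.
by rewrite ler_pXn2r ?nnegrE// lerDl.
Qed.

(** One shift of e gains a factor 1/n on g_n = O(1/n), which yields a
    convergent majorant. *)
Lemma gauss_summable_bound e : ~ nonpos_int e -> gauss_summable e ->
  exists2 M : K, 0 < M & forall n, `|gauss (e + 1) n| <= M / n.+1%:R ^+ 2.
Proof.
move=> he [cg g0].
have [M M0 gM] : exists2 M : K, 0 < M & forall n, `|(n%:R + 1) * gauss e n| <= M.
  apply: cvgn_bounded; apply: (cvgP (0 + 0)).
  under eq_fun do rewrite mulrDl mul1r.
  by apply: cvgD => //; exact: cvg_series_cvg_0.
have [M' M'0 eM'] := inv_natrD_bound K_harmonic e.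
have e0 : e != 0 by have := nonpos_int_neq0 0 he; rewrite addr0.
exists (M * (`|e| * M')); first by rewrite !mulr_gt0 ?normr_gt0.
move=> n; rewrite gauss_shift // mulrCA [e + _]addrC [gauss e n]/(gauss e n).
have n0 : 0 < n.+1%:R :> K by rewrite ltr0n.
have -> : e * (gauss e n / (n%:R + e)) =
   ((n%:R + 1) * gauss e n) * (e * (n%:R + e)^-1) / n.+1%:R.
  rewrite [n%:R + e]addrC natr1; field.
  by rewrite nat1r pnatr_eq0 nonpos_int_neq0.
move: (gauss e n) (gM n) (eM' n) => g gn en.
have -> : M * (`|e| * M') / n.+1%:R ^+ 2 = M * (`|e| * (M' / n.+1%:R)) / n.+1%:R.
  by rewrite expr2 invfM !mulrA.
rewrite !normrM [`|n.+1%:R^-1|]normfV normr_nat ler_pM2r ?invr_gt0 //.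
rewrite ler_pM // ?mulr_ge0 //; first by rewrite -normrM.
by rewrite ler_pM2l ?normr_gt0.
Qed.

(** For n >= 1 the n-th term at e + N is at most |e + J| / |e + N| times the one
    at e + J, for a fixed J and all N >= J: passing from N to N + 1 multiplies
    it by (e + N) / (e + N + n), and |e + N + n| >= |e + N + 1|.  So the whole
    tail is O(1/N). *)
Lemma cvg_gauss_shift_limit e : ~ nonpos_int e -> ~ nonpos_int (e - a - c) ->
    gauss_summable e ->
  (fun N => limn (series (gauss (e + N%:R)))) @ \oo --> (1 : K).
Proof.
move=> he hs sg.
have sgN N := (gauss_iterate N he hs sg).2.
have heN N := nonpos_intD (k := N) he.
have [J eJ] := norm_natrD_le e.
have [M M0 gM] := gauss_summable_bound (heN J) (sgN J).
have {gM} gM n : `|gauss (e + J.+1%:R) n| <= M / n.+1%:R ^+ 2.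
  by rewrite -natr1 addrA.
pose D := `|e + J.+1%:R|.
have D0 : 0 <= D by exact: normr_ge0.
have gN N n : (J < N)%N ->
    `|gauss (e + N%:R) n.+1| <= D / `|e + N%:R| * (M / n.+1%:R ^+ 2).
  elim: N => // N IH; rewrite ltnS leq_eqVlt => /orP[/eqP <-|JN].
    rewrite divff ?mul1r ?normr_eq0 ?nonpos_int_neq0 // (le_trans (gM _))//.
    rewrite ler_pM2l // lef_pV2 ?posrE ?exprn_gt0 ?ltr0n //.
    by rewrite ler_pXn2r ?nnegrE // ler_nat.
  have eN0 : `|e + N.+1%:R| != 0 by rewrite normr_eq0 nonpos_int_neq0.
  have eN : `|e + N%:R| != 0 by rewrite normr_eq0 nonpos_int_neq0.
  rewrite -[in gauss _]natr1 addrA gauss_shift //.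
  move: (gauss _ _) (IH JN) => g gle; rewrite normrM normf_div.
  have -> : D / `|e + N.+1%:R| * (M / n.+1%:R ^+ 2) =
      D / `|e + N%:R| * (M / n.+1%:R ^+ 2) * (`|e + N%:R| / `|e + N.+1%:R|).
    by field; rewrite eN eN0 nat1r pnatr_eq0.
  rewrite ler_pM // ?divr_ge0 // ler_pM2l ?lt0r ?eN ?normr_ge0 //.
  have eNn0 : `|e + N%:R + n.+1%:R| != 0.
    by rewrite normr_eq0 -addrA -natrD nonpos_int_neq0.
  rewrite lef_pV2 ?posrE ?lt0r ?eN0 ?eNn0 ?normr_ge0 //.
  by rewrite -addrA -natrD -addSnnS eJ // leqW // ltnW.
have sN N n : (J < N)%N ->
    `|series (gauss (e + N%:R)) n.+1 - 1| <= D / `|e + N%:R| * (M * 2).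
  move=> JN; rewrite /series /= big_nat_recl //= gauss0 addrC addKr.
  rewrite (le_trans (ler_norm_sum _ _ _))//.
  rewrite (le_trans (ler_sum _ (fun n _ => gN N n JN)))//.
  rewrite -mulr_sumr ler_wpM2l ?divr_ge0 // -mulr_sumr ler_wpM2l ?(ltW M0)//.
  exact: sum_inv_sqr_le2.
apply: (cvg_dominated (v := fun N => D * (M * 2) * `|(N%:R + e)^-1| + N.+1%:R^-1)).
  exists J.+1 => // N /= JN.
  have N0 : 0 < N.+1%:R^-1 :> K by rewrite invr_gt0 ltr0n.
  have /cvgrPdist_lt/(_ _ N0)[n0 _ /(_ n0.+1 (leqnSn n0))] := (sgN N).1.
  set S := limn _ => /ltW Sn.
  have -> : S - 1 = (series (gauss (e + N%:R)) n0.+1 - 1)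
      + (S - series (gauss (e + N%:R)) n0.+1) by ring.
  rewrite (le_trans (ler_normD _ _))// lerD //.
  by rewrite normfV [N%:R + e]addrC (le_trans (sN N n0 JN)) // mulrAC.
have h0 : (fun N => `|(N%:R + e)^-1|) @ \oo --> (0 : K).
  by apply/norm_cvg0P; exact: cvg_inv_natrD.
suff : (fun N => D * (M * 2) * `|(N%:R + e)^-1| + N.+1%:R^-1) @ \oo
    --> (D * (M * 2) * 0 + 0 : K) by rewrite mulr0 addr0.
by apply: cvgD => //; apply: cvgM => //; exact: cvg_cst.
Qed.

(** Form of the Gauss theorem free of the Gamma function. *)
Lemma gauss_sum_limit e p : ~ nonpos_int e -> ~ nonpos_int (e - a - c) ->
    gauss_summable e ->
    (fun N => rising (e - a) N * rising (e - c) N / (rising e N * rising (e - a - c) N))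
      @ \oo --> (p : K) ->
  limn (series (gauss e)) = p.
Proof.
move=> he hs sg cp.
suff h : (fun=> limn (series (gauss e))) @ \oo --> p * 1.
  by rewrite -[RHS]mulr1; apply: (cvg_unique _ _ h) => //; exact: cvg_cst.
under eq_fun => N do rewrite (gauss_iterate N he hs sg).1.
by apply: cvgM => //; exact: cvg_gauss_shift_limit.
Qed.

End Gauss.

(** * The recurrence in the parameter b *)

Section Certificate.
Variable K : fieldType.
Implicit Types a b c e f : K.

(** Polynomial part of the telescoping certificate.  Gosper summation asks for a
    polynomial of degree one; evaluating the identity below at x = - f gives the
    ratio of its values at - f and 1 - f, hence the polynomial up to a factor. *)
Definition cert_poly k a b c e f (x : K) : K :=
  (x + f) * cfalpha k.+1 a b c e f - (a - f) * (c - f) * (b - f).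

Lemma cert_identity k a b c e f (x : K) :
  (f + x) *
    (- (cfalpha k a b c e f * (k%:R + 1) * (b - a + k%:R + 1)
          * (b - c + k%:R + 1))
     + cfB k a b c e f * (b + x + k%:R + 1)
     - cfalpha k.+1 a b c e f * (e - a - c - 1 + k%:R)
         * (b + x + k%:R) * (b + x + k%:R + 1))
  = (a + x) * (c + x) * (b + x) * cert_poly k a b c e f (x + 1)
    - x * (e + x - 1) * (b + x + k%:R + 1) * cert_poly k a b c e f x.
Proof. rewrite /cert_poly /cfB /cfbeta /cfalpha -natr1; ring. Qed.

End Certificate.

Section Recurrence.
Local Open Scope classical_set_scope.
Variable K : numClosedFieldType.
Hypothesis K_complete : quadratic_complete K.
Hypothesis K_harmonic : @harmonic K @ \oo --> 0.
Variables a b c e f : K.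
Hypotheses (he : ~ nonpos_int e) (hf : ~ nonpos_int f).
Hypothesis (hb1 : ~ nonpos_int (b + 1)).

Let g := gauss a c e.
(** The k-th series of the recurrence; for k = 0 only its terms matter. *)
Definition F43_term k := hyp_term [:: a; b; c; f + 1] [:: b + k%:R; e; f].
Let t := F43_term.

Let bk_nonpos k : (0 < k)%N -> ~ nonpos_int (b + k%:R).
Proof. by case: k => // k _; rewrite -nat1r addrA; exact: nonpos_intD. Qed.

Let f0 : f != 0. Proof. by have := nonpos_int_neq0 0 hf; rewrite addr0. Qed.

Lemma F43_term_gauss k n : ~ nonpos_int (b + k%:R) ->
  t k n = g n * ((f + n%:R) / f) * (rising b n / rising (b + k%:R) n).
Proof.
move=> hbk; rewrite /t /F43_term /g /gauss /hyp_term !big_cons !big_nil !mulr1.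
have : rising (f + 1) n = rising f n * (f + n%:R) / f.
  by rewrite -risingS rising_shift mulrC mulKf.
move=> ->.
have := rising_neq0 n hbk; have := rising_neq0 n hf; have := rising_neq0 n he.
have : n`!%:R != 0 :> K by rewrite pnatr_eq0 -lt0n fact_gt0.
by move=> h1 h2 h3 h4; field; rewrite h1 h2 h3 h4 f0.
Qed.

(** Raising k divides the n-th term by n + b + k, up to a constant, so that
    Abel summation gives the convergence of all later series. *)
Lemma F43_term_shift k n : (0 < k)%N ->
  t k.+1 n = (b + k%:R) * (t k n / (n%:R + (b + k%:R))).
Proof.
move=> k0; have hbk := bk_nonpos k0; have hbk1 := @bk_nonpos k.+1 isT.
rewrite !F43_term_gauss //.
have := rising_shift (b + k%:R) n; rewrite -addrA natr1 risingS => rE.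
have h0 : b + k%:R != 0 by have := nonpos_int_neq0 0 hbk; rewrite addr0.
have -> : rising (b + k.+1%:R) n = rising (b + k%:R) n * (b + k%:R + n%:R) / (b + k%:R).
  by rewrite rE mulrC mulKf.
have h1 := nonpos_int_neq0 n hbk; have h2 := rising_neq0 n hbk.
by rewrite [n%:R + _]addrC; field; rewrite h0 h1 h2 f0.
Qed.

Lemma cvg_F43 k : cvgn (series (t 1)) -> cvgn (series (t k.+1)).
Proof.
move=> c1; elim: k => // k IH.
have -> : t k.+2 = (fun n => (b + k.+1%:R) * (t k.+1 n / (n%:R + (b + k.+1%:R)))).
  by apply/funext => n; exact: F43_term_shift.
apply: is_cvg_seriesM; apply: cvg_series_div_natrD => //.
exact: bk_nonpos.
Qed.

Section NonZero.
Hypothesis b0 : b != 0.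

Let hb : ~ nonpos_int b.
Proof.
case=> -[|n] bn; first by move: b0; rewrite bn oppr0 eqxx.
by apply: hb1; exists n; rewrite bn -natr1 opprD subrK.
Qed.

Let hbk k : ~ nonpos_int (b + k%:R). Proof. exact: nonpos_intD. Qed.

Lemma F43_term_rising k n :
  t k n = g n * ((f + n%:R) / f) * (rising b k / rising (b + n%:R) k).
Proof.
rewrite F43_term_gauss //; congr (_ * _).
have h1 := rising_neq0 n (hbk (k:=k)); have h2 := rising_neq0 k (hbk (k := n)).
by apply/eqP; rewrite eqr_div // -!risingD addnC.
Qed.

Lemma gauss_summable_F43 : cvgn (series (t 1)) -> gauss_summable a c e.
Proof.
move=> c1; apply: cvg_gauss_summable => //.
have -> : gauss a c e = (fun n => f / b * t 1 n + f / b * (b - f) * (t 1 n / (n%:R + f))).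
  apply/funext => n; rewrite F43_term_rising /g !risingS !rising0 !mul1r !addr0.
  have h1 := nonpos_int_neq0 n hb; have h2 := nonpos_int_neq0 n hf.
  by rewrite [n%:R + f]addrC; field; rewrite ?h1 ?h2 ?f0 ?b0.
apply: is_cvg_series_add; apply: is_cvg_seriesM => //.
exact: cvg_series_div_natrD.
Qed.

Definition cert k n : K :=
  g n * (n%:R * (e + n%:R - 1) * cert_poly k a b c e f n%:R)
  * (rising b k.+1 / (f * rising (b + n%:R) k.+1)).

Lemma cert_telescope k n :
  cfA k a b c e f * t k.+2 n + cfB k a b c e f * t k.+1 n + cfC k a b c e f * t k n
  = cert k n.+1 - cert k n.
Proof.
have H := cert_identity k a b c e f n%:R.
have r0 := rising_neq0 k (hbk (k := n)).
have bn := nonpos_int_neq0 n hb.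
have bk : b + k%:R + 1 != 0 by rewrite -addrA natr1 nonpos_int_neq0.
have bnk : b + n%:R + k%:R != 0 by rewrite -addrA -natrD nonpos_int_neq0.
have bnk1 : b + n%:R + k%:R + 1 != 0 by rewrite -!addrA natr1 -natrD nonpos_int_neq0.
have en := nonpos_int_neq0 n he.
have n1 : n%:R + 1 != 0 :> K by rewrite natr1 pnatr_eq0.
have rS : rising (b + n.+1%:R) k.+1 =
   rising (b + n%:R) k * (b + n%:R + k%:R) * (b + n%:R + k%:R + 1) / (b + n%:R).
  have -> : b + n.+1%:R = b + n%:R + 1 by rewrite -addrA natr1.
  rewrite -[rising (_ + 1) _](mulKf bn) -rising_shift mulrC !risingS -natr1.
  by rewrite [b + n%:R + (_ + 1)]addrA.
rewrite !F43_term_rising /cert rS !risingS [in X in _ = X - _]/g gaussS -/(gauss a c e) -/g.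
(* Both sides are [cert_identity] at x = n multiplied by w. *)
set w := g n * rising b k * (b + k%:R) /
  (f * rising (b + n%:R) k * (b + n%:R + k%:R) * (b + n%:R + k%:R + 1)).
rewrite /cfA /cfC -!natr1.
transitivity (w * ((f + n%:R) *
  (- (cfalpha k a b c e f * (k%:R + 1) * (b - a + k%:R + 1)
        * (b - c + k%:R + 1))
     + cfB k a b c e f * (b + n%:R + k%:R + 1)
     - cfalpha k.+1 a b c e f * (e - a - c - 1 + k%:R)
         * (b + n%:R + k%:R) * (b + n%:R + k%:R + 1)))).
  rewrite /w; move: (cfB _ _ _ _ _ _) (cfalpha _ _ _ _ _ _).
  move: (cfalpha _ _ _ _ _ _) => al1 B al.
  by field; rewrite r0 bk bnk bnk1 f0.
rewrite H /w; move: (cert_poly _ _ _ _ _ _ _) (cert_poly _ _ _ _ _ _ _) => p q.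
by field; rewrite r0 bn bnk bnk1 f0 en n1.
Qed.

(** [cert 0] without its part that does not tend to 0.  Since
    cert_poly 0 x = alpha_1 (x + b) + cert_poly 0 (- b), that part is a multiple
    of n (e + n - 1) g_n, whose increments are (a c - (s - 1) n) g_n. *)
Let cert0 n : K :=
  n%:R * g n * ((e + n%:R - 1) / (n%:R + b))
  * (b / f * cert_poly 0 a b c e f (- b)).

(** The contribution C(0) F_0 is replaced by a multiple of the Gauss series. *)
Lemma cert0_telescope n :
  cfA 0 a b c e f * t 2 n + cfB 0 a b c e f * t 1 n
  - cfalpha 1 a b c e f * b * (e - a - c - 1 + a * c / f) * g n
  = cert0 n.+1 - cert0 n.
Proof.
have := cert_telescope 0 n.
have bn := nonpos_int_neq0 n hb.
have bn1 : b + n%:R + 1 != 0 by rewrite -addrA natr1 nonpos_int_neq0.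
have en := nonpos_int_neq0 n he.
have n1 : n%:R + 1 != 0 :> K by rewrite natr1 pnatr_eq0.
rewrite [t 0 n]F43_term_rising !rising0 divr1 mulr1 /cert /cert0.
rewrite !risingS !rising0 !mul1r !addr0.
rewrite -[n.+1%:R]natr1 [n%:R + b]addrC [n%:R + 1 + b]addrC addrA.
rewrite [g n.+1]gaussS -/(gauss a c e) -/g -[n.+1%:R]natr1.
rewrite /cert_poly /cfC; move: (cfA _ _ _ _ _ _) (cfB _ _ _ _ _ _) (cfalpha _ _ _ _ _ _).
move=> A B al H.
rewrite -[A * _ + B * _](addrK
  (- (al * (b + 0%:R) * (e - a - c - 1 + 0%:R)) * (g n * ((f + n%:R) / f)))) H.
by field; rewrite [b + (_ + 1)]addrA bn bn1 f0 en n1.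
Qed.

Lemma cvg_inv_rising y j : cvgn (fun n => (rising (y + n%:R) j)^-1 : K).
Proof.
elim: j => [|j IH].
  by under eq_fun do rewrite rising0; exact: is_cvg_cst.
have -> : (fun n => (rising (y + n%:R) j.+1)^-1) =
    (fun n => (rising (y + n%:R) j)^-1 * (n%:R + (y + j%:R))^-1).
  by apply/funext => n; rewrite risingS invfM; congr (_ * _^-1); ring.
by apply: is_cvgM => //; apply: cvgP; exact: cvg_inv_natrD.
Qed.

Lemma cvg_cert k : gauss_summable a c e -> cert k.+1 @ \oo --> (0 : K).
Proof.
move=> [_ g0].
have [l hl] : exists l : K, (fun n => (rising (b + 2 + n%:R) k)^-1) @ \oo --> l.
  by exists (limn (fun n => (rising (b + 2 + n%:R) k)^-1)); exact: cvg_inv_rising.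
pose al := cfalpha k.+2 a b c e f; pose q := (a - f) * (c - f) * (b - f).
have -> : cert k.+1 = (fun n => n%:R * g n * ((n%:R + (e - 1)) / (n%:R + b)) *
    (al * ((n%:R + f) / (n%:R + (b + 1))) - q * (n%:R + (b + 1))^-1) *
    ((rising (b + 2 + n%:R) k)^-1 * (rising b k.+2 / f))).
  apply/funext => n; rewrite /cert /cert_poly -/al -/q.
  have bn := nonpos_int_neq0 n hb.
  have bn1 : b + n%:R + 1 != 0 by rewrite -addrA natr1 nonpos_int_neq0.
  have r0 : rising (b + 2 + n%:R) k != 0.
    by rewrite -addrA -natrD rising_neq0.
  rewrite [rising (b + n%:R) _]rising_shift rising_shift.
  have -> : b + n%:R + 1 + 1 = b + 2 + n%:R by ring.
  have -> : n%:R + (b + 1) = b + n%:R + 1 by ring.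
  by rewrite [n%:R + b]addrC; field; rewrite f0 r0 bn1 bn.
suff : (fun n => n%:R * g n * ((n%:R + (e - 1)) / (n%:R + b)) *
    (al * ((n%:R + f) / (n%:R + (b + 1))) - q * (n%:R + (b + 1))^-1) *
    ((rising (b + 2 + n%:R) k)^-1 * (rising b k.+2 / f))) @ \oo -->
   (0 * 1 * (al * 1 - q * 0) * (l * (rising b k.+2 / f)) : K)
  by rewrite !mul0r.
apply: cvgM; last by apply: cvgM => //; exact: cvg_cst.
apply: cvgM.
  by apply: cvgM => //; exact: cvg_ratio_natrD.
apply: cvgB; apply: cvgM; try exact: cvg_cst; first exact: cvg_ratio_natrD.
exact: cvg_inv_natrD.
Qed.

Lemma cvg_cert0 : gauss_summable a c e -> cert0 @ \oo --> (0 : K).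
Proof.
move=> [_ g0].
suff : cert0 @ \oo --> (0 * 1 * (b / f * cert_poly 0 a b c e f (- b)) : K).
  by rewrite !mul0r.
apply: cvgM; last exact: cvg_cst.
apply: cvgM => //; under eq_fun do rewrite -addrA addrCA.
exact: cvg_ratio_natrD.
Qed.

Lemma F43_recurrenceS k : cvgn (series (t 1)) ->
  cfA k.+1 a b c e f * limn (series (t k.+3)) +
  cfB k.+1 a b c e f * limn (series (t k.+2)) +
  cfC k.+1 a b c e f * limn (series (t k.+1)) = 0.
Proof.
move=> c1; have sg := gauss_summable_F43 c1.
have cu := cvg_seriesD (cvg_seriesD
  (cvg_seriesM (x := cfA k.+1 a b c e f) (cvg_F43 (k := k.+2) c1))
  (cvg_seriesM (x := cfB k.+1 a b c e f) (cvg_F43 (k := k.+1) c1)))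
  (cvg_seriesM (x := cfC k.+1 a b c e f) (cvg_F43 (k := k) c1)).
have := cvg_series_telescope (cert_telescope k.+1) (cvg_cert k sg).
have -> : cert k.+1 0 = 0 by rewrite /cert !mul0r mulr0 mul0r.
rewrite subr0 => u0.
exact: cvg_unique cu u0.
Qed.

Lemma F43_recurrence0 : cvgn (series (t 1)) ->
  cfA 0 a b c e f * limn (series (t 2)) + cfB 0 a b c e f * limn (series (t 1))
  = cfalpha 1 a b c e f * b * (e - a - c - 1 + a * c / f) * limn (series g).
Proof.
move=> c1; have sg := gauss_summable_F43 c1.
have cu := cvg_seriesD (cvg_seriesD
  (cvg_seriesM (x := cfA 0 a b c e f) (cvg_F43 (k := 1) c1))
  (cvg_seriesM (x := cfB 0 a b c e f) c1))
  (cvg_seriesM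
    (x := - (cfalpha 1 a b c e f * b * (e - a - c - 1 + a * c / f))) sg.1).
apply/eqP; rewrite -subr_eq0 -mulNr; apply/eqP.
have u_tele n : cfA 0 a b c e f * t 2 n + cfB 0 a b c e f * t 1 n +
    - (cfalpha 1 a b c e f * b * (e - a - c - 1 + a * c / f)) * g n
    = cert0 n.+1 - cert0 n by rewrite -cert0_telescope; ring.
have := cvg_series_telescope u_tele (cvg_cert0 sg).
have -> : cert0 0 = 0 by rewrite /cert0 !mul0r.
rewrite subr0 => u0.
exact: cvg_unique cu u0.
Qed.

End NonZero.

Lemma F43_term_b0 k : b = 0 -> (0 < k)%N -> series (t k) @ \oo --> (1 : K).
Proof.
move=> b0 k0; rewrite -cvg_shiftS /=.
have -> : (fun n => series (t k) n.+1) = fun=> 1; last exact: cvg_cst.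
apply/funext => n; rewrite /series /= big_nat_recl //= big1 ?addr0.
  exact: hyp_term0.
move=> i _; rewrite F43_term_gauss ?rising_shift ?b0 ?mul0r ?mulr0 // -b0.
exact: bk_nonpos.
Qed.

(** At index 0, where the series may diverge, stands the value that the Gauss
    theorem assigns to it. *)
Definition F43_seq (G : K) k :=
  if k is 0 then (e - a - c - 1 + a * c / f) * G else limn (series (t k)).

(** If b = 0 all series are 1 and C(0) = 0; the relation
    A(k) + B(k) + C(k) = 0 is then [cert_identity] at x = 0. *)
Lemma F43_recurrence (G : K) : cvgn (series (t 1)) ->
  (b != 0 -> gauss_summable a c e -> limn (series g) = (e - a - c - 1) * G) ->
  forall k, cfA k a b c e f * F43_seq G k.+2 + cfB k a b c e f * F43_seq G k.+1
    + cfC k a b c e f * F43_seq G k = 0.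
Proof.
move=> c1 hG k; have [b0|b0] := eqVneq b 0; last first.
  case: k => [|k]; last exact: F43_recurrenceS.
  rewrite F43_recurrence0 // hG //; last exact: gauss_summable_F43.
  by rewrite /F43_seq /cfC; ring.
have F1 j : F43_seq G j.+1 = 1 by apply: cvg_lim => //; exact: F43_term_b0.
have := cert_identity k a b c e f 0; rewrite !addr0 !mul0r b0 !mulr0 !mul0r subr0.
have k1 : k%:R + 1 != 0 :> K by rewrite natr1 pnatr_eq0.
move=> /eqP; rewrite mulf_eq0 (negPf f0) orFb => /eqP H.
have fC : cfC k a 0 c e f * F43_seq G k = cfC k a 0 c e f.
  by case: k {H k1} => [|k]; rewrite ?F1 ?mulr1// /cfC addr0 mulr0 mul0r oppr0 mul0r.
rewrite !F1 fC !mulr1.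
apply: (mulIf k1); rewrite mul0r -[RHS]H /cfA /cfC; move: (cfB _ _ _ _ _ _) => B.
by field; rewrite k1.
Qed.

End Recurrence.

Lemma rec_sol_linear (K : fieldType) (a b c e f q0 G : K) (u : nat -> K) m :
    (forall k, (k.+1 < m)%N -> cfA k a b c e f != 0) ->
    (forall k, cfA k a b c e f * u k.+2 + cfB k a b c e f * u k.+1
       + cfC k a b c e f * u k = 0) ->
    u 0%N = q0 * G ->
  u m = rec_sol a b c e f 0 1 m * u 1%N + rec_sol a b c e f q0 0 m * G.
Proof.
move=> A0 rec_u u0.
have [k] := ubnP m; elim: k m A0 => // k IH [|[|m]] A0 mk.
- by rewrite /rec_sol /= mul0r add0r.
- by rewrite /rec_sol /= mul1r mul0r addr0.
rewrite !rec_solSS.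
have A0m := A0 m (ltnSn _).
have u1 := IH m.+1 (fun j jm => A0 j (ltnW jm)) mk.
have u2 := IH m (fun j jm => A0 j (ltnW (ltnW jm))) (ltnW mk).
have -> : u m.+2 = - (cfB m a b c e f / cfA m a b c e f) * u m.+1
    - cfC m a b c e f / cfA m a b c e f * u m.
  apply: (mulfI A0m); apply/eqP; rewrite -subr_eq0; apply/eqP.
  by rewrite -[RHS](rec_u m); field.
by rewrite u1 u2; ring.
Qed.

(** * Complex sequences and the complex exponential *)

Section RealBounds.
Variable R : realType.
Implicit Types x y : R.

(** The upper bound comes from (1 - x) exp x <= 1, which is the convexity bound
    at - x. *)
Lemma expR_sub1_bound x : `|x| <= 2^-1 -> 0 <= expR x - 1 - x <= 2 * x ^+ 2.
Proof.
rewrite ler_norml => /andP[x1 x2].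
have h1 := expR_ge1Dx x; have h2 := expR_ge1Dx (- x).
have h3 := expR_gt0 x; rewrite expRN in h2.
have h4 : (1 - x) * expR x <= 1 by rewrite -ler_pdivlMr // mul1r.
apply/andP; split; first lra.
nra.
Qed.

Lemma norm_sin_le y : `|sin y| <= `|y|.
Proof.
wlog y0 : y / 0 <= y.
  move=> h; have [/h//|/ltW y0] := leP 0 y.
  by rewrite -normrN -sinN -[leRHS]normrN h // oppr_ge0.
have [|c _] := @MVT_segment R sin cos 0 y y0 _ _.
  by apply: continuous_subspaceT => z; exact: continuous_sin.
by rewrite sin0 !subr0 => ->; rewrite normrM ler_piMl // cos_max.
Qed.

Lemma norm_cos_sub1_le y : `|cos y - 1| <= y ^+ 2.
Proof.
wlog y0 : y / 0 <= y.
  move=> h; have [/h//|/ltW y0] := leP 0 y.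
  by rewrite -cosN -sqrrN h // oppr_ge0.
have [|c] := @MVT_segment R cos (fun x => - sin x) 0 y y0 _ _.
  by apply: continuous_subspaceT => z; exact: continuous_cos.
rewrite in_itv /= cos0 !subr0 => /andP[c0 cy] ->.
rewrite normrM normrN expr2 [`|y|]ger0_norm // ler_wpM2r //.
by rewrite (le_trans (norm_sin_le _))// ger0_norm.
Qed.

Lemma norm_sin_sub_le y : `|y| <= 1 -> `|sin y - y| <= y ^+ 2.
Proof.
wlog y0 : y / 0 <= y.
  move=> h; have [/h//|/ltW y0] := leP 0 y.
  have -> : sin y - y = - (sin (- y) - - y) by rewrite sinN; ring.
  by rewrite normrN -sqrrN -[`|y|]normrN; apply: h; rewrite oppr_ge0.
rewrite ger0_norm // => y1.
have [|c] := @MVT_segment R (fun x => sin x - x) (fun x => cos x - 1) 0 y y0 _ _.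
  apply: continuous_subspaceT => z; apply: cvgB => //; exact: continuous_sin.
rewrite in_itv /= sin0 !subr0 => /andP[c0 cy] ->.
rewrite normrM expr2 [`|y|]ger0_norm // ler_wpM2r //.
rewrite (le_trans (norm_cos_sub1_le _))// expr2.
by rewrite (le_trans _ cy)// ler_piMl // (le_trans cy).
Qed.

End RealBounds.

Section RealQuadratic.
Local Open Scope classical_set_scope.
Variable R : realType.

(** With y_n = 2 m / (n + 1), the sequences x - y and x + y are adjacent. *)
Lemma real_quadratic_complete : quadratic_complete R.
Proof.
move=> x m xm; pose y : R^nat := fun n => 2 * m * harmonic n.
have m0 : 0 <= m by have := xm 0%N; rewrite expr1n divr1; exact: le_trans.
have ym n : `|x n.+1 - x n| <= y n - y n.+1.
  rewrite (le_trans (xm n))// /y -mulrBr /harmonic /= -subr_ge0.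
  have n1 : n%:R + 1 != 0 :> R by rewrite natr1 pnatr_eq0.
  have n2 : n%:R + 2 != 0 :> R by rewrite -natrD addn2 pnatr_eq0.
  have -> : 2 * m * (n.+1%:R^-1 - n.+2%:R^-1) - m / n.+1%:R ^+ 2 =
      m * n%:R / ((n%:R + 1) ^+ 2 * (n%:R + 2)) :> R.
    by rewrite -[n.+2]addn2 -[n.+1]addn1 !natrD; field; rewrite n1 n2.
  by rewrite divr_ge0 ?mulr_ge0 // ?exprn_ge0 // ?addr_ge0.
have y0 : y @ \oo --> (0 : R).
  rewrite -(mulr0 (2 * m)); apply: cvgM; [exact: cvg_cst|exact: cvg_harmonic].
have cD : ((x : R^nat) + y) - (x - y) = y + y.
  by rewrite opprB addrC addrA subrK.
have [_ _ cv] : [/\ limn ((x : R^nat) + y) = limn ((x : R^nat) - y),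
    cvgn ((x : R^nat) - y) & cvgn ((x : R^nat) + y)].
  apply: adjacent_seq; last by rewrite cD -(addr0 (0 : R)); exact: cvgD.
    apply/nondecreasing_seqP => n; have := ym n; rewrite ler_norml => /andP[].
    by rewrite -[(_ - _) n]/(x n - y n) -[(_ - _) n.+1]/(x n.+1 - y n.+1); lra.
  apply/nonincreasing_seqP => n; have := ym n; rewrite ler_norml => /andP[].
  by rewrite -[(_ + _) n]/(x n + y n) -[(_ + _) n.+1]/(x n.+1 + y n.+1); lra.
have : cvgn ((x : R^nat) + y - y) by apply: is_cvgB => //; apply: cvgP y0.
by rewrite addrK.
Qed.

End RealQuadratic.

Section ComplexSequences.
Local Open Scope classical_set_scope.
Variable R : realType.
Notation Re := complex.Re.
Notation Im := complex.Im.
Implicit Types (z : R[i]) (u : nat -> R[i]).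

Lemma complex_norm_le z : `|z| <= ((`|Re z| + `|Im z|)%:C)%C.
Proof.
case: z => x y /=.
have -> : (x +i* y)%C = (x%:C)%C + 'i%C * (y%:C)%C by exact: (complexE (x +i* y)%C).
rewrite (le_trans (ler_normD _ _))// normrM.
rewrite rmorphD /= lerD //.
  by rewrite normc_def /= expr0n addr0 sqrtr_sqr.
by rewrite !normc_def /= expr0n expr1n add0r addr0 sqrtr1 mul1r sqrtr_sqr.
Qed.

Lemma norm_Re_le z : ((`|Re z|)%:C)%C <= `|z|.
Proof.
by rewrite normc_def lecR -sqrtr_sqr ler_wsqrtr // lerDl sqr_ge0.
Qed.

Lemma norm_Im_le z : ((`|Im z|)%:C)%C <= `|z|.
Proof.
by rewrite normc_def lecR -sqrtr_sqr ler_wsqrtr // lerDr sqr_ge0.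
Qed.

Lemma cvg_complex u (x y : R) : (fun n => Re (u n)) @ \oo --> x ->
  (fun n => Im (u n)) @ \oo --> y -> (u : nat -> R[i]^o) @ \oo --> ((x +i* y)%C : R[i]^o).
Proof.
move=> cx cy; apply/cvgrPdist_lt => e e0.
have eE : e = ((Re e)%:C)%C.
  by rewrite [LHS]complexE (ger0_Im (ltW e0)) mulr0 addr0.
have e2 : 0 < Re e / 2 by rewrite divr_gt0 // -ltcR -eE.
have /cvgrPdist_lt/(_ _ e2) hx := cx; have /cvgrPdist_lt/(_ _ e2) := cy.
move: hx; apply: filterS2 => n hx hy.
rewrite (le_lt_trans (complex_norm_le _))// eE ltcR raddfB /= raddfB /=.
by rewrite [ltRHS]splitr ltrD.
Qed.

Lemma complex_quadratic_complete : quadratic_complete R[i].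
Proof.
move=> u M uM.
have M0 : 0 <= M by have := uM 0%N; rewrite expr1n divr1; exact: le_trans.
have ME : M = ((Re M)%:C)%C by rewrite [LHS]complexE (ger0_Im M0) mulr0 addr0.
have h n : M / n.+1%:R ^+ 2 = ((Re M / n.+1%:R ^+ 2)%:C)%C.
  by rewrite {1}ME rmorphM fmorphV rmorphXn rmorph_nat.
have /cvg_ex[x cx] : cvgn (fun n => Re (u n)).
  apply: (@real_quadratic_complete R _ (Re M)) => n; rewrite -raddfB /=.
  by rewrite -lecR -h (le_trans (norm_Re_le _)).
have /cvg_ex[y cy] : cvgn (fun n => Im (u n)).
  apply: (@real_quadratic_complete R _ (Re M)) => n; rewrite -raddfB /=.
  by rewrite -lecR -h (le_trans (norm_Im_le _)).
by apply: cvgP; exact: cvg_complex cx cy.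
Qed.

Lemma complex_cvg_harmonic : (@harmonic R[i] : nat -> R[i]^o) @ \oo --> (0 : R[i]^o).
Proof.
have hE n : harmonic n = ((harmonic n)%:C)%C :> R[i].
  by rewrite /harmonic /= fmorphV rmorph_nat.
apply: cvg_complex.
  by under eq_fun do rewrite hE /=; exact: cvg_harmonic.
by under eq_fun do rewrite hE /=; exact: cvg_cst.
Qed.

Lemma expCD z w : expC (z + w) = expC z * expC w.
Proof.
case: z w => [x y] [x' y']; rewrite /expC /=; apply/eqP; rewrite eq_complex /=.
rewrite expRD cosD sinD; apply/andP; split; apply/eqP; ring.
Qed.

Lemma expC0 : expC (0 : R[i]) = 1.
Proof. by rewrite /expC /= expR0 cos0 sin0 !mulr1 mulr0. Qed.

Lemma expC_real (x : R) : expC (x%:C)%C = ((expR x)%:C)%C.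
Proof. by rewrite /expC /= cos0 sin0 mulr1 mulr0. Qed.

Lemma expC_neq0 z : expC z != 0.
Proof.
apply/eqP => z0; have := expCD z (- z); rewrite subrr expC0 z0 mul0r => /eqP.
by rewrite oner_eq0.
Qed.

(** Second-order estimate of the exponential, from the real ones applied to
    exp x cos y and exp x sin y. *)
Lemma expC_sub1_bound z : `|z| <= 2^-1 -> `|expC z - 1 - z| <= 8 * `|z| ^+ 2.
Proof.
move=> z1.
have := norm_Re_le z; have := norm_Im_le z.
have [r rE] : exists r : R, `|z| = (r%:C)%C.
  by exists (Num.sqrt (Re z ^+ 2 + Im z ^+ 2)); rewrite normc_def.
rewrite rE !lecR.
have r1 : r <= 2^-1 by rewrite -lecR -rE fmorphV rmorph_nat.
have -> : 8 * (r%:C)%C ^+ 2 = ((8 * r ^+ 2)%:C)%C by rewrite rmorphM rmorphXn rmorph_nat.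
case: z {z1 rE} => x y /= yr xr.
have x1 := le_trans xr r1; have y1 := le_trans yr r1.
rewrite (le_trans (complex_norm_le _))// lecR /= subr0.
have y1' : `|y| <= 1 by rewrite (le_trans y1)// invf_le1 // ler1n.
have /andP[e1 e2] := expR_sub1_bound x1.
have s1 := norm_sin_le y; have s2 := norm_sin_sub_le y1'; have c1 := norm_cos_sub1_le y.
have x2 : x ^+ 2 <= r ^+ 2.
  by rewrite -real_normK ?num_real // ler_sqr ?nnegrE // (le_trans _ xr).
have y2 : y ^+ 2 <= r ^+ 2.
  by rewrite -[y ^+ 2]real_normK ?num_real // ler_sqr ?nnegrE // (le_trans _ yr).
have r0 : 0 <= r by rewrite (le_trans _ xr).
have eR : expR x <= 2.
  by move: x1; rewrite ler_norml => /andP[]; nra.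
have h1 : `|expR x * cos y - 1 - x| <= 4 * r ^+ 2.
  have -> : expR x * cos y - 1 - x = (expR x - 1 - x) + expR x * (cos y - 1) by ring.
  rewrite (le_trans (ler_normD _ _))// normrM (ger0_norm e1) (ger0_norm (expR_ge0 x)).
  have : expR x * `|cos y - 1| <= 2 * y ^+ 2 by rewrite ler_pM // expR_ge0.
  lra.
have h2 : `|expR x * sin y - y| <= 4 * r ^+ 2.
  have -> : expR x * sin y - y = (expR x - 1) * sin y + (sin y - y) by ring.
  rewrite (le_trans (ler_normD _ _))// normrM.
  have ex1 : `|expR x - 1| <= 2 * r.
    move: x1; rewrite !ler_norml => /andP[x1 x3].
    by move: xr; rewrite ler_norml => /andP[x4 x5]; apply/andP; split; nra.
  have : `|expR x - 1| * `|sin y| <= 2 * r * r.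
    by rewrite ler_pM // (le_trans s1).
  lra.
lra.
Qed.

End ComplexSequences.

(** * The Gamma function and the Gauss summation theorem *)

Section Gamma.
Local Open Scope classical_set_scope.
Variable R : realType.
Implicit Types z : R[i].

Let C_complete := @complex_quadratic_complete R.
Let C_harmonic := @complex_cvg_harmonic R.

Definition log_ratio n : R := ln (n.+2%:R / n.+1%:R).

Lemma log_ratio_bounds n : n.+2%:R^-1 <= log_ratio n <= n.+1%:R^-1.
Proof.
have n1 : 0 < n.+1%:R :> R by rewrite ltr0n.
have n2 : 0 < n.+2%:R :> R by rewrite ltr0n.
have nE : n.+2%:R = n.+1%:R + 1 :> R by rewrite natr1.
rewrite /log_ratio; apply/andP; split.
  rewrite -lerN2 -lnV ?posrE ?divr_gt0 // invf_div.
  have -> : n.+1%:R / n.+2%:R = 1 + - n.+2%:R^-1 :> R.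
    by rewrite nE; field; rewrite !(natr1, nat1r, =^~ natrD) pnatr_eq0.
  by apply: le_ln1Dx; rewrite ltrN2 invf_lt1 // ltr1n.
have -> : n.+2%:R / n.+1%:R = 1 + n.+1%:R^-1 :> R.
  by rewrite nE; field; rewrite !(natr1, nat1r, =^~ natrD) pnatr_eq0.
by apply: le_ln1Dx; rewrite (lt_trans (ltrN10 _)) // invr_gt0.
Qed.

Lemma natpowC_S n z :
  natpowC n.+2 z = natpowC n.+1 z * expC (z * ((log_ratio n)%:C)%C).
Proof.
rewrite /natpowC -expCD -mulrDr -rmorphD /log_ratio ln_div ?posrE ?ltr0n //.
by rewrite addrC subrK.
Qed.

Lemma natpowCD n z w : natpowC n (z + w) = natpowC n z * natpowC n w.
Proof. by rewrite /natpowC mulrDl expCD. Qed.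

Lemma natpowC_neq0 n z : natpowC n z != 0.
Proof. exact: expC_neq0. Qed.

Lemma natpowC1 n : natpowC n.+1 1 = n.+1%:R :> R[i].
Proof.
by rewrite /natpowC mul1r expC_real lnK ?posrE ?ltr0n // rmorph_nat.
Qed.

(** The exponential expands to first order at z log((n+2)/(n+1)), and this
    logarithm lies between 1/(n+2) and 1/(n+1). *)
Lemma log_ratio_expC z : exists2 M : R[i], 0 <= M & exists N0 : nat,
  forall n, (N0 <= n)%N ->
  `|expC (z * ((log_ratio n)%:C)%C) - 1 - z / n.+2%:R| <= M / n.+1%:R ^+ 2.
Proof.
exists (8 * `|z| ^+ 2 + `|z|); first by rewrite addr_ge0 // mulr_ge0 // exprn_ge0.
have [N0 hN0] := natr_norm_bound C_harmonic (2 * z).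
exists N0 => n Nn.
set d : R[i] := ((log_ratio n)%:C)%C.
have /andP[d1 d2] := log_ratio_bounds n.
have {}d1 : n.+2%:R^-1 <= d by rewrite -(rmorph_nat (real_complex R)) -fmorphV lecR.
have {}d2 : d <= n.+1%:R^-1 by rewrite -(rmorph_nat (real_complex R)) -fmorphV lecR.
have n1 : 0 < n.+1%:R :> R[i] by rewrite ltr0n.
have n2 : 0 < n.+2%:R :> R[i] by rewrite ltr0n.
have d0 : 0 <= d by rewrite (le_trans _ d1) // invr_ge0 ltW.
have zd : `|z * d| <= `|z| / n.+1%:R.
  by rewrite normrM (ger0_norm d0) ler_wpM2l.
have zd2 : `|z * d| <= 2^-1.
  rewrite (le_trans zd)// ler_pdivrMr // mulrC ler_pdivlMr // mulrC.
  rewrite -[2]normr_nat -normrM (le_trans hN0)// ler_nat.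
  exact: leqW.
have -> : expC (z * d) - 1 - z / n.+2%:R =
   (expC (z * d) - 1 - z * d) + z * (d - n.+2%:R^-1) by ring.
rewrite (le_trans (ler_normD _ _))// mulrDl lerD //.
  rewrite (le_trans (expC_sub1_bound zd2))// -mulrA ler_wpM2l //.
  by rewrite -exprVn -exprMn ler_pXn2r ?nnegrE // divr_ge0 // ltW.
rewrite normrM ler_wpM2l // ger0_norm ?subr_ge0 //.
rewrite (le_trans (lerB d2 (lexx _)))//.
have -> : n.+1%:R^-1 - n.+2%:R^-1 = (n.+1%:R * n.+2%:R)^-1 :> R[i].
  have -> : n.+2%:R = n.+1%:R + 1 :> R[i] by rewrite natr1.
  by field; rewrite !(natr1, nat1r, =^~ natrD) !pnatr_eq0.
rewrite lef_pV2 ?posrE ?exprn_gt0 ?mulr_gt0 // expr2 ler_pM2l //.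
by rewrite ler_nat.
Qed.

Definition gamma_seq z n : R[i] := n`!%:R * natpowC n z / rising z n.+1.

Lemma gamma_seq_neq0 z n : ~ nonpos_int z -> gamma_seq z n != 0.
Proof.
move=> hz; rewrite /gamma_seq !mulf_neq0 ?invr_eq0 ?expC_neq0 ?rising_neq0 //.
by rewrite pnatr_eq0 -lt0n fact_gt0.
Qed.

Lemma gamma_seqS z n : ~ nonpos_int z ->
  gamma_seq z n.+2 = gamma_seq z n.+1 *
    (n.+2%:R * expC (z * ((log_ratio n)%:C)%C) / (z + n.+2%:R)).
Proof.
move=> hz; rewrite /gamma_seq natpowC_S [n.+2`!]factS natrM [rising z n.+3]risingS.
by field; rewrite -natrD nonpos_int_neq0 // rising_neq0.
Qed.

(** By [log_ratio_expC] at z and - z, the successive ratios of the sequence and of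
    its inverse are 1 + O(1/n^2). *)
Lemma cvg_gamma_seq z : ~ nonpos_int z ->
  exists2 l : R[i], l != 0 & (gamma_seq z : nat -> R[i]^o) @ \oo --> (l : R[i]^o).
Proof.
move=> hz.
(* The index is shifted because n ^ z is only meaningful for n > 0. *)
pose u n : R[i] := gamma_seq z n.+1.
have u0 n : u n != 0 by exact: gamma_seq_neq0.
have zn n : z + n.+2%:R != 0 by exact: nonpos_int_neq0.
have n20 n : n.+2%:R != 0 :> R[i] by rewrite pnatr_eq0.
suff [l l0 cl] : exists2 l : R[i], l != 0 & (u : nat -> R[i]^o) @ \oo --> (l : R[i]^o).
  exists l; first exact: l0.
  by rewrite -cvg_shiftS; exact: cl.
have [M M0 [N0 hM]] := log_ratio_expC z.
have [B B0 hB] : exists2 B : R[i], 0 < B &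
    forall n, `|(n%:R + 2) / (n%:R + (z + 2))| <= B.
  by apply: cvgn_bounded; apply: cvgP; exact: (cvg_ratio_natrD C_harmonic).
have [M' M0' [N0' hM']] := log_ratio_expC (- z).
apply: (cvg_quadratic_ratio_neq0 C_complete C_harmonic (M := B * M)
  (M' := `|z| ^+ 2 + (1 + `|z|) * M') (N0 := N0) (N0' := N0')) => //.
- by rewrite !mulr_ge0 // ltW.
- by rewrite addr_ge0 ?exprn_ge0 // mulr_ge0 // addr_ge0.
- move=> n Nn; rewrite /u gamma_seqS // -/(u n).
  set E := expC _; have := hM n Nn; rewrite -/E => hE.
  have -> : u n * (n.+2%:R * E / (z + n.+2%:R)) - u n =
      u n * ((n.+2%:R / (z + n.+2%:R)) * (E - 1 - z / n.+2%:R)).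
    by move: (n.+2%:R) (zn n) (n20 n) => k zk k0; field; rewrite zk k0.
  rewrite normrM ler_wpM2l // normrM -mulrA ler_pM //.
  have -> : n.+2%:R = n%:R + 2 :> R[i] by rewrite -natrD addn2.
  by rewrite [z + _]addrCA; exact: hB.
- move=> n Nn; rewrite /u gamma_seqS // -/(u n).
  have := hM' n Nn; set E := expC (- z * _).
  have EV : E = (expC (z * ((log_ratio n)%:C)%C))^-1.
    apply: (mulIf (expC_neq0 (z * ((log_ratio n)%:C)%C))).
    by rewrite mulVf ?expC_neq0 // -expCD mulNr addNr expC0.
  have -> : expC (z * ((log_ratio n)%:C)%C) = E^-1 by rewrite EV invrK.
  have E0 : E != 0 by exact: expC_neq0.
  move: E E0 {EV} => E E0 hE.
  have -> : (u n * (n.+2%:R * E^-1 / (z + n.+2%:R)))^-1 - (u n)^-1 =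
      (u n)^-1 * (- (z ^+ 2 / n.+2%:R ^+ 2)
        + (1 + z / n.+2%:R) * (E - 1 - - z / n.+2%:R)).
    move: (n.+2%:R) (zn n) (n20 n) (u0 n) => k zk k0 un0.
    by field; rewrite zk k0 E0 un0.
  rewrite normrM ler_wpM2l // (le_trans (ler_normD _ _))// [leRHS]mulrDl.
  have n2 : (n.+2%:R ^+ 2)^-1 <= (n.+1%:R ^+ 2)^-1 :> R[i].
    by rewrite lef_pV2 ?posrE ?exprn_gt0 ?ltr0n // ler_pXn2r ?nnegrE // ler_nat.
  rewrite lerD //.
    by rewrite normrN normrM normfV !normrX normr_nat ler_wpM2l // exprn_ge0.
  rewrite normrM -mulrA ler_pM // (le_trans (ler_normD _ _))// normr1 lerD2l.
  by rewrite normrM normfV normr_nat ler_piMr // invf_le1 ?ltr0n // ler1n.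
Qed.

Lemma cvg_GammaC z : ~ nonpos_int z ->
  (gamma_seq z : nat -> R[i]^o) @ \oo --> (GammaC z : R[i]^o).
Proof.
move=> /cvg_gamma_seq[l _ cl]; suff -> : GammaC z = l by [].
exact: cvg_lim cl.
Qed.

Lemma GammaC_neq0 z : ~ nonpos_int z -> GammaC z != 0.
Proof.
move=> hz; have [l l0 cl] := cvg_gamma_seq hz.
by rewrite (cvg_unique _ (cvg_GammaC hz) cl).
Qed.

(** Up to the factor s - 1 and ratios tending to 1, the finite product of
    [gauss_sum_limit] is the quotient of the sequences defining the four Gamma
    values: the powers of n cancel because
    e + (s - 1) + 1 = (e - a) + (e - c). *)
Lemma gauss_sum (a c e : R[i]) :
    ~ nonpos_int e -> ~ nonpos_int (e - a - c - 1) ->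
    ~ nonpos_int (e - a) -> ~ nonpos_int (e - c) ->
    gauss_summable a c e ->
  limn (series (gauss a c e)) = (e - a - c - 1) *
    (GammaC e * GammaC (e - a - c - 1) / (GammaC (e - a) * GammaC (e - c))).
Proof.
move=> he hs ha hc sg.
have hs1 : ~ nonpos_int (e - a - c) by have := nonpos_intD (k := 1) hs; rewrite subrK.
apply: (gauss_sum_limit C_complete C_harmonic he hs1 sg).
rewrite -(cvg_shiftS).
have -> : (fun N => rising (e - a) N.+1 * rising (e - c) N.+1 /
     (rising e N.+1 * rising (e - a - c) N.+1)) = (fun n => (e - a - c - 1) *
    (gamma_seq e n.+1 * gamma_seq (e - a - c - 1) n.+1
      / (gamma_seq (e - a) n.+1 * gamma_seq (e - c) n.+1)
    * ((n%:R + (e + 1)) / (n%:R + (e - a + 1)) * ((n%:R + 1) / (n%:R + (e - c + 1)))))).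
  apply/funext => n; rewrite /gamma_seq.
  have pe : natpowC n.+1 e * natpowC n.+1 (e - a - c - 1) * n.+1%:R =
      natpowC n.+1 (e - a) * natpowC n.+1 (e - c).
    by rewrite -natpowC1 -!natpowCD; congr natpowC; ring.
  have -> : natpowC n.+1 e = natpowC n.+1 (e - a) * natpowC n.+1 (e - c)
     / (natpowC n.+1 (e - a - c - 1) * n.+1%:R).
    by rewrite -pe; field; rewrite ?expC_neq0 ?nat1r ?natr1 ?pnatr_eq0.
  rewrite [rising (e - a - c - 1) _]rising_shift subrK ![rising _ n.+2]risingS.
  have s0 : e - a - c - 1 != 0 by have := nonpos_int_neq0 0 hs; rewrite addr0.
  have := nonpos_int_neq0 n.+1 he; have := nonpos_int_neq0 n.+1 ha.
  have := nonpos_int_neq0 n.+1 hc.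
  have -> : n%:R + (e + 1) = e + n.+1%:R by rewrite -natr1; ring.
  have -> : n%:R + (e - a + 1) = e - a + n.+1%:R by rewrite -natr1; ring.
  have -> : n%:R + (e - c + 1) = e - c + n.+1%:R by rewrite -natr1; ring.
  rewrite natr1.
  have := rising_neq0 n.+1 hc; have := rising_neq0 n.+1 ha.
  have := rising_neq0 n.+1 he; have := rising_neq0 n.+1 hs1.
  have : n.+1`!%:R != 0 :> R[i] by rewrite pnatr_eq0 -lt0n fact_gt0.
  have : n.+1%:R != 0 :> R[i] by rewrite pnatr_eq0.
  have := natpowC_neq0 n.+1 (e - a); have := natpowC_neq0 n.+1 (e - c).
  have := natpowC_neq0 n.+1 (e - a - c - 1).
  move: (rising _ _) (rising _ _) (rising _ _) (rising _ _).
  move: (natpowC _ _) (natpowC _ _) (natpowC _ _) (n.+1`!%:R).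
  move: (n.+1%:R) => N p1 p2 p3 F r1 r2 r3 r4 *.
  by field; do !(apply/andP; split).
suff : (fun n => (e - a - c - 1) *
    (gamma_seq e n.+1 * gamma_seq (e - a - c - 1) n.+1
      / (gamma_seq (e - a) n.+1 * gamma_seq (e - c) n.+1)
    * ((n%:R + (e + 1)) / (n%:R + (e - a + 1)) * ((n%:R + 1) / (n%:R + (e - c + 1)))))
    : R[i]^o) @ \oo -->
  ((e - a - c - 1) * (GammaC e * GammaC (e - a - c - 1) / (GammaC (e - a) * GammaC (e - c))
     * (1 * 1)) : R[i]^o) by rewrite !mulr1.
have gS z : ~ nonpos_int z ->
    (fun n => gamma_seq z n.+1 : R[i]^o) @ \oo --> (GammaC z : R[i]^o).
  by move=> hz; have := cvg_GammaC hz; rewrite -cvg_shiftS.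
apply: cvgM; first exact: cvg_cst.
apply: cvgM; last by apply: cvgM; exact: (cvg_ratio_natrD C_harmonic).
apply: cvgM; first by apply: cvgM; exact: gS.
apply: cvgV; first by rewrite mulf_neq0 // GammaC_neq0.
by apply: cvgM; exact: gS.
Qed.

End Gamma.

(** * The theorem *)

Theorem theorem2 (R : realType) :
  exists Rm Qm : nat -> ratfun 5 R[i],
    (let a := ratvar5 R[i] 0 in
     let b := ratvar5 R[i] 1 in
     let c := ratvar5 R[i] 2 in
     let e := ratvar5 R[i] 3 in
     let f := ratvar5 R[i] 4 in
     [/\ Rm 0%N = 0 /\ Rm 1%N = 1,
         Qm 0%N = e - a - c - 1 + a * c / f /\ Qm 1%N = 0,
         ABC_rec a b c e f Rm
       & ABC_rec a b c e f Qm])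
    /\
    (forall (m : nat) (a b c e f : R[i]),
       (2 <= m)%N ->
       ~ nonpos_int (b + m%:R) ->
       ~ nonpos_int (b + 1) ->
       ~ nonpos_int e ->
       ~ nonpos_int f ->
       ~ nonpos_int (e - a - c - 1) ->
       ~ nonpos_int (e - a) ->
       ~ nonpos_int (e - c) ->
       (forall k : nat, (k <= m - 2)%N -> cfA k a b c e f != 0) ->
       hyp_cvg [:: a; b; c; f + 1] [:: b + m%:R; e; f] ->
       hyp_cvg [:: a; b; c; f + 1] [:: b + 1; e; f] ->
       [/\ rat_defined (Rm m) (point5 a b c e f),
           rat_defined (Qm m) (point5 a b c e f)
         & hypF [:: a; b; c; f + 1] [:: b + m%:R; e; f]
           = rat_eval (Rm m) (point5 a b c e f)
               * hypF [:: a; b; c; f + 1] [:: b + 1; e; f]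
             + rat_eval (Qm m) (point5 a b c e f)
               * (GammaC e * GammaC (e - a - c - 1)
                  / (GammaC (e - a) * GammaC (e - c)))]).
Proof.
pose ra := ratvar5 R[i] 0; pose rb := ratvar5 R[i] 1; pose rc := ratvar5 R[i] 2.
pose re := ratvar5 R[i] 3; pose rf := ratvar5 R[i] 4.
pose q0 := re - ra - rc - 1 + ra * rc / rf.
exists (rec_sol ra rb rc re rf 0 1), (rec_sol ra rb rc re rf q0 0).
split; first by split=> //; exact: rec_sol_ABC.
move=> m a b c e f m2 hbm hb1 he hf hs hea hec hA cm c1.
have f0 : f != 0 by have := nonpos_int_neq0 0 hf; rewrite addr0.
have nz k : (k.+1 < m)%N -> b + k%:R + 1 != 0 /\ cfA k a b c e f != 0.
  move=> km; split; first by rewrite addrAC nonpos_int_neq0.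
  by apply: hA; rewrite leq_subRL.
pose v := point5 a b c e f.
have va : has_value v ra a by exact: (has_value_var5 a b c e f (j := 0)).
have vb : has_value v rb b by exact: (has_value_var5 a b c e f (j := 1)).
have vc : has_value v rc c by exact: (has_value_var5 a b c e f (j := 2)).
have ve : has_value v re e by exact: (has_value_var5 a b c e f (j := 3)).
have vf : has_value v rf f by exact: (has_value_var5 a b c e f (j := 4)).
have vq0 : has_value v q0 (e - a - c - 1 + a * c / f).
  rewrite /q0; apply: has_valueD; last first.
    by apply: has_value_div => //; exact: has_valueM.
  apply: has_valueB; last exact: has_value1.
  by apply: has_valueB => //; exact: has_valueB.
have vR := has_value_rec_sol va vb vc ve vf (has_value0 v) (has_value1 v) nz.
have vQ := has_value_rec_sol va vb vc ve vf vq0 (has_value0 v) nz.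
split; [exact: has_value_defined vR|exact: has_value_defined vQ|].
set G := _ / (_ * _).
have rec_F :=
  F43_recurrence (@complex_quadratic_complete R) (@complex_cvg_harmonic R)
  he hf hb1 c1 (fun _ sg => gauss_sum he hs hea hec sg).
have F_sol := rec_sol_linear (fun k km => (nz k km).2) rec_F (erefl _).
have -> : hypF [:: a; b; c; f + 1] [:: b + m%:R; e; f] = F43_seq a b c e f G m.
  by case: (m) m2.
rewrite F_sol; congr (_ * _ + _ * _).
  exact/esym/(has_value_eval vR).
exact/esym/(has_value_eval vQ).
Qed.
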